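(* Let $R$ be a ring with identity. Suppose $\mathrm{findim}(R^{\mathrm{op}})<\infty$. Then: (1) If $\mathcal{K}^b(R\text{-proj})$ has a bounded $t$-structure, then $\mathcal{K}^b(R\text{-proj})=\mathcal{K}^{-,b}(R\text{-proj})$. In particular, if $R$ is left coherent, then $\mathcal{K}^b(R\text{-proj})$ has a bounded $t$-structure if and only if $\mathcal{K}^b(R\text{-proj})=\mathcal{D}^b(R\text{-mod})$. (2) All bounded $t$-structures on any triangulated category between $\mathcal{K}^b(R\text{-proj})$ and $\mathcal{K}^{-,b}(R\text{-proj})$ are equivalent.
   Context: Rings are associative; $R^{\mathrm{op}}$ is the opposite ring. $\mathrm{findim}(R)$ is the supremum of the projective dimensions of those left $R$-modules having a finite projective resolution by finitely generated projective $R$-modules. $R\text{-proj}$ and $R\text{-mod}$ are the categories of finitely generated projective and of finitely presented left $R$-modules. $\mathcal{K}^b(R\text{-proj})$ is the bounded homotopy category, and $\mathcal{K}^{-,b}(R\text{-proj})$ the homotopy category of bounded above (cochain) complexes of finitely generated projective left $R$-modules with bounded cohomology; subcategories are taken closed under isomorphism, so the equality in (1) means that every object of the larger category is isomorphic to one of the smaller. If $R$ is left coherent, $\mathcal{K}^{-,b}(R\text{-proj})$ is canonically triangle equivalent to $\mathcal{D}^b(R\text{-mod})$, and these categories are identified. ''A triangulated category between $\mathcal{A}$ and $\mathcal{B}$'' means a full triangulated subcategory of $\mathcal{B}$ containing $\mathcal{A}$. A $t$-structure on a triangulated category $\mathcal{X}$ is a pair of full subcategories $(\mathcal{X}^{\leq0},\mathcal{X}^{\geq0})$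 such that, with $\mathcal{X}^{\leq n}:=\mathcal{X}^{\leq0}[-n]$, $\mathcal{X}^{\geq n}:=\mathcal{X}^{\geq0}[-n]$: $\mathcal{X}^{\leq-1}\subseteq\mathcal{X}^{\leq0}$, $\mathcal{X}^{\geq0}\subseteq\mathcal{X}^{\geq-1}$; $\mathrm{Hom}(\mathcal{X}^{\leq-1},\mathcal{X}^{\geq0})=0$; each $X$ fits into a triangle $X'\to X\to X''\to X'[1]$ with $X'\in\mathcal{X}^{\leq-1}$, $X''\in\mathcal{X}^{\geq0}$. It is bounded if $\mathcal{X}=\bigcup_n\mathcal{X}^{\leq n}=\bigcup_n\mathcal{X}^{\geq-n}$. Two $t$-structures are equivalent if $\mathcal{X}_1^{\leq-n}\subseteq\mathcal{X}_2^{\leq0}\subseteq\mathcal{X}_1^{\leq n}$ for some $n\in\mathbb{N}$. *)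

(* Defs.v *)
(* K(R-Mod) is the ambient triangulated category: its objects are the cochain
   complexes of left R-modules, its morphisms the chain maps modulo homotopy.
   Hom-sets are not quotiented; equality of morphisms is [homotopic] and
   isomorphism of objects is [hiso].  A full subcategory closed under
   isomorphism is a predicate on complexes. *)
From HB Require Import structures.
From mathcomp Require Import all_boot all_order all_algebra.

Set Implicit Arguments.
Unset Strict Implicit.
Unset Printing Implicit Defensive.

Import Order.TTheory GRing.Theory Num.Theory.
Local Open Scope ring_scope.

Section Modules.
Variable R : pzRingType.
Implicit Types M N : lmodType R.

Definition projective M : Prop :=
  forall (A B : lmodType R) (g : {linear A -> B}) (f : {linear M -> B}),
    (forall b, exists a, g a = b) ->
    exists h : {linear M -> A}, forall x, g (h x) = f x.

Definition fin_gen M : Prop :=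
  exists n (p : {linear 'rV[R]_n -> M}), forall m, exists x, p x = m.

Definition fin_pres M : Prop :=
  exists m n (g : {linear 'rV[R]_m -> 'rV[R]_n}) (p : {linear 'rV[R]_n -> M}),
    (forall z, exists x, p x = z) /\
    (forall x, p x = 0 <-> exists y, g y = x).

Definition fg_proj M : Prop := fin_gen M /\ projective M.

(* A finitely generated left ideal is a finitely generated module I together
   with an injective linear map into the regular module R^o. *)
Definition left_coherent : Prop :=
  forall (I : lmodType R) (i : {linear I -> R^o}),
    injective i -> fin_gen I -> fin_pres I.

(* An exact sequence 0 -> P n -> ... -> P 0 -> M -> 0 with all P k in Q. *)
Definition resolution_of_length (Q : lmodType R -> Prop) M (n : nat) : Prop :=
  exists (P : nat -> lmodType R) (d : forall k, {linear P k.+1 -> P k})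
         (e : {linear P 0%N -> M}),
    [/\ forall k, Q (P k),
        forall k, (n < k)%N -> forall x : P k, x = 0,
        forall m, exists x, e x = m,
        forall x, e x = 0 <-> exists y, d 0%N y = x &
        forall k x, d k x = 0 <-> exists y, d k.+1 y = x].

Definition projdim_le M n : Prop := resolution_of_length projective M n.

Definition findim_le n : Prop :=
  forall M, (exists m, resolution_of_length fg_proj M m) -> projdim_le M n.

(* findim is a supremum in N U {infinity}: it is finite iff it is bounded. *)
Definition findim_finite : Prop := exists n, findim_le n.

End Modules.

(* The differential is indexed by all pairs (i, j) and vanishes unless
   j = i + 1, so that X[n] needs no transport along (i + n) + 1 = (i + 1) + n. *)
Record cochain (R : pzRingType) := Cochain {
  cob :> int -> lmodType R;
  cdiff : forall i j, {linear cob i -> cob j};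
  cdiff_eq0 : forall i j, j != i + 1 -> forall x, cdiff i j x = 0;
  cdiffK : forall i j k x, cdiff j k (cdiff i j x) = 0
}.

Record chain_map (R : pzRingType) (X Y : cochain R) := ChainMap {
  cmap :> forall i, {linear X i -> Y i};
  cmapP : forall i j x, cmap j (cdiff X i j x) = cdiff Y i j (cmap i x)
}.

Section Complexes.
Variable R : pzRingType.
Implicit Types X Y Z : cochain R.

Lemma cm_id_proof X i j x :
  (idfun : {linear X j -> X j}) (cdiff X i j x)
  = cdiff X i j ((idfun : {linear X i -> X i}) x).
Proof. by []. Qed.

Definition cm_id X : chain_map X X := ChainMap (@cm_id_proof X).

Lemma cm_comp_proof X Y Z (g : chain_map Y Z) (f : chain_map X Y) i j x :
  (g j \o f j : {linear X j -> Z j}) (cdiff X i j x)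
  = cdiff Z i j ((g i \o f i : {linear X i -> Z i}) x).
Proof. by rewrite /= !cmapP. Qed.

Definition cm_comp X Y Z (g : chain_map Y Z) (f : chain_map X Y) :
  chain_map X Z := ChainMap (cm_comp_proof g f).

Definition homotopic X Y (f g : chain_map X Y) : Prop :=
  exists h : forall i j, {linear X i -> Y j}, forall i x,
    f i x - g i x = cdiff Y (i - 1) i (h i (i - 1) x)
                  + h (i + 1) i (cdiff X i (i + 1) x).

Definition null_homotopic X Y (f : chain_map X Y) : Prop :=
  exists h : forall i j, {linear X i -> Y j}, forall i x,
    f i x = cdiff Y (i - 1) i (h i (i - 1) x)
          + h (i + 1) i (cdiff X i (i + 1) x).

Definition hequiv X Y (f : chain_map X Y) : Prop :=
  exists g : chain_map Y X,
    homotopic (cm_comp g f) (cm_id X) /\ homotopic (cm_comp f g) (cm_id Y).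

Definition hiso X Y : Prop := exists f : chain_map X Y, hequiv f.

Definition zero_complex X : Prop := forall i (x : X i), x = 0.

(* Shift: X[n] in degree i is X in degree i + n, with differential
    (-1)^n d. *)

Definition sign_lin (U V : lmodType R) (b : bool) (f : {linear U -> V}) :
  {linear U -> V} := if b then \- f : {linear U -> V} else f.

Lemma sign_linE (U V : lmodType R) b (f : {linear U -> V}) x :
  sign_lin b f x = if b then - f x else f x.
Proof. by case: b. Qed.

Section Shift.
Variables (n : int) (X : cochain R).

Definition shift_diff (i j : int) : {linear X (i + n) -> X (j + n)} :=
  sign_lin (odd `|n|%N) (cdiff X (i + n) (j + n)).

Lemma shift_diff_eq0 i j : j != i + 1 -> forall x, shift_diff i j x = 0.
Proof.
move=> ne_ji x; rewrite sign_linE cdiff_eq0 ?oppr0 ?if_same //.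
by apply: contra ne_ji => /eqP e; apply/eqP/(addIr n); rewrite e addrAC.
Qed.

Lemma shift_diffK i j k x : shift_diff j k (shift_diff i j x) = 0.
Proof. by rewrite !sign_linE; case: odd; rewrite ?linearN /= cdiffK ?oppr0. Qed.

Definition shift : cochain R :=
  @Cochain R (fun i => X (i + n)) shift_diff shift_diff_eq0 shift_diffK.

End Shift.

Lemma shift_map_proof n X Y (f : chain_map X Y) i j x :
  f (j + n) (cdiff (shift n X) i j x) = cdiff (shift n Y) i j (f (i + n) x).
Proof. by rewrite /= !sign_linE; case: odd; rewrite ?linearN /= cmapP. Qed.

Definition shift_map n X Y (f : chain_map X Y) :
  chain_map (shift n X) (shift n Y) :=
  @ChainMap R (shift n X) (shift n Y) (fun i => f (i + n))
    (@shift_map_proof n X Y f).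

(* Mapping cone of f : X -> Y: in degree i it is X (i + 1) * Y i, with
    differential (x, y) |-> (- d x, f x + d y). *)

Section Cone.
Variables (X Y : cochain R) (f : chain_map X Y).

(* f (i + 1), read as a map into Y j when j = i + 1. *)
Definition cone_glue (i j : int) : {linear X (i + 1) -> Y j} :=
  if @eqP _ (i + 1) j is ReflectT e
  then ecast k ({linear X (i + 1) -> Y k}) e (f (i + 1))
  else \0 : {linear X (i + 1) -> Y j}.

Lemma cone_glueE i x : cone_glue i (i + 1) x = f (i + 1) x.
Proof.
rewrite /cone_glue; case: eqP => // e.
by rewrite (eq_irrelevance e erefl).
Qed.

Lemma cone_glue_eq0 i j : j != i + 1 -> forall x, cone_glue i j x = 0.
Proof. by rewrite /cone_glue; case: eqP => // e /eqP[]. Qed.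

Definition cone_diff_fun (i j : int) (z : (X (i + 1)%R * Y i)%type) :
    (X (j + 1)%R * Y j)%type :=
  (- cdiff X (i + 1) (j + 1) z.1, cone_glue i j z.1 + cdiff Y i j z.2).

Lemma cone_diff_is_linear i j : linear (@cone_diff_fun i j).
Proof.
move=> a [x y] [x' y']; rewrite /cone_diff_fun /=; congr pair.
  by rewrite linearP /= opprD scalerN.
by rewrite !linearP /= scalerDr addrACA.
Qed.

HB.instance Definition _ i j :=
  GRing.isLinear.Build R _ _ _ (@cone_diff_fun i j) (@cone_diff_is_linear i j).

Definition cone_diff (i j : int) :
    {linear (X (i + 1)%R * Y i)%type -> (X (j + 1)%R * Y j)%type} :=
  @cone_diff_fun i j.

Lemma cone_diff_eq0 i j : j != i + 1 -> forall z, cone_diff i j z = 0.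
Proof.
move=> ne_ji z; rewrite /= /cone_diff_fun cone_glue_eq0 // !cdiff_eq0 //.
  by rewrite oppr0 addr0.
by apply: contra ne_ji => /eqP /addIr ->.
Qed.

Lemma cone_diffK i j k z : cone_diff j k (cone_diff i j z) = 0.
Proof.
have [ji|ne_ji] := eqVneq j (i + 1); last by rewrite (cone_diff_eq0 ne_ji) linear0.
have [kj|ne_kj] := eqVneq k (j + 1); last exact: cone_diff_eq0.
subst j; subst k; rewrite /= /cone_diff_fun /= !cone_glueE !linearN !linearD /=.
by rewrite !cdiffK cmapP addr0 addNr linear0 oppr0.
Qed.

Definition cone : cochain R :=
  @Cochain R (fun i => (X (i + 1)%R * Y i)%type) cone_diff
    cone_diff_eq0 cone_diffK.

Definition cone_in_fun (i : int) (y : Y i) : cone i := (0, y).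

Lemma cone_in_is_linear i : linear (@cone_in_fun i).
Proof. by move=> a x y; congr pair; rewrite /= scaler0 addr0. Qed.

HB.instance Definition _ i :=
  GRing.isLinear.Build R _ _ _ (@cone_in_fun i) (@cone_in_is_linear i).

Lemma cone_in_proof i j y :
  (@cone_in_fun j : {linear _ -> _}) (cdiff Y i j y)
  = cdiff cone i j ((@cone_in_fun i : {linear _ -> _}) y).
Proof. by congr pair; rewrite /= !linear0 ?oppr0 ?add0r. Qed.

Definition cone_in : chain_map Y cone := ChainMap cone_in_proof.

Definition cone_out_fun (i : int) (z : cone i) : shift 1 X i := z.1.

Lemma cone_out_is_linear i : linear (@cone_out_fun i).
Proof. by []. Qed.

HB.instance Definition _ i :=
  GRing.isLinear.Build R _ _ _ (@cone_out_fun i) (@cone_out_is_linear i).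

Lemma cone_out_proof i j z :
  (@cone_out_fun j : {linear _ -> _}) (cdiff cone i j z)
  = cdiff (shift 1 X) i j ((@cone_out_fun i : {linear _ -> _}) z).
Proof. by []. Qed.

Definition cone_out : chain_map cone (shift 1 X) := ChainMap cone_out_proof.

End Cone.

(* Distinguished triangles X -> Y -> Z -> X[1]: those isomorphic in K(R-Mod)
   to X' -> Y' -> cone f -> X'[1] for some chain map f : X' -> Y'. *)
Definition triangle X Y Z (u : chain_map X Y) (v : chain_map Y Z)
    (w : chain_map Z (shift 1 X)) : Prop :=
  exists (X' Y' : cochain R) (f : chain_map X' Y')
         (a : chain_map X X') (b : chain_map Y Y') (c : chain_map Z (cone f)),
    [/\ hequiv a, hequiv b & hequiv c] /\
    [/\ homotopic (cm_comp b u) (cm_comp f a),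
        homotopic (cm_comp c v) (cm_comp (cone_in f) b) &
        homotopic (cm_comp (shift_map 1 a) w) (cm_comp (cone_out f) c)].

Definition iso_closed (T : cochain R -> Prop) : Prop :=
  forall X Y, T X -> hiso X Y -> T Y.

Definition subcat (S T : cochain R -> Prop) : Prop := forall X, S X -> T X.

Record triangulated (T : cochain R -> Prop) : Prop := Triangulated {
  tri_iso : iso_closed T;
  tri_zero : forall X, zero_complex X -> T X;
  tri_shift : forall n X, T X -> T (shift n X);
  tri_cone : forall X Y Z (u : chain_map X Y) (v : chain_map Y Z)
    (w : chain_map Z (shift 1 X)), triangle u v w -> T X -> T Y -> T Z
}.

Definition shifted (L : cochain R -> Prop) (n : int) (X : cochain R) : Prop :=
  exists2 Y, L Y & hiso X (shift n Y).

(* X^{<= n} = X^{<= 0}[-n] and X^{>= n} = X^{>= 0}[-n]. *)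
Definition deg (L : cochain R -> Prop) (n : int) := shifted L (- n).

Record t_structure (T L G : cochain R -> Prop) : Prop := TStructure {
  ts_subL : subcat L T;
  ts_subG : subcat G T;
  ts_isoL : iso_closed L;
  ts_isoG : iso_closed G;
  ts_monoL : subcat (deg L (-1)) L;
  ts_monoG : subcat G (deg G (-1));
  ts_hom0 : forall X Y (f : chain_map X Y),
    deg L (-1) X -> G Y -> null_homotopic f;
  ts_trunc : forall X, T X ->
    exists (X' X'' : cochain R) (u : chain_map X' X) (v : chain_map X X'')
           (w : chain_map X'' (shift 1 X')),
      [/\ deg L (-1) X', G X'' & triangle u v w]
}.

Definition bounded_t_structure (T L G : cochain R -> Prop) : Prop :=
  [/\ t_structure T L G,
      forall X, T X <-> exists n : nat, deg L n%:Z X &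
      forall X, T X <-> exists n : nat, deg G (- n%:Z) X].

Definition has_bounded_t_structure (T : cochain R -> Prop) : Prop :=
  exists L G, bounded_t_structure T L G.

Definition t_equivalent (L1 L2 : cochain R -> Prop) : Prop :=
  exists n : nat, subcat (deg L1 (- n%:Z)) L2 /\ subcat L2 (deg L1 n%:Z).

Definition bounded_above X : Prop :=
  exists n : int, forall i, n < i -> forall x : X i, x = 0.

Definition bounded X : Prop :=
  exists a b : int, forall i, (i < a) || (b < i) -> forall x : X i, x = 0.

Definition acyclic_at X (i : int) : Prop :=
  forall x : X i, cdiff X i (i + 1) x = 0 ->
    exists y : X (i - 1), cdiff X (i - 1) i y = x.

Definition bounded_cohomology X : Prop :=
  exists a b : int, forall i, (i < a) || (b < i) -> acyclic_at X i.

(* K^b(R-proj) and K^{-,b}(R-proj), closed under isomorphism in K(R-Mod). *)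
Definition Kb_proj X : Prop :=
  exists P, [/\ bounded P, forall i, fg_proj (P i) & hiso X P].

Definition Kmb_proj X : Prop :=
  exists P, [/\ bounded_above P, bounded_cohomology P,
                forall i, fg_proj (P i) & hiso X P].

(* f induces, for every i, an injection and a surjection on H^i = Ker / Im. *)
Definition quasi_iso X Y (f : chain_map X Y) : Prop :=
  forall i,
    (forall x : X i, cdiff X i (i + 1) x = 0 ->
       (exists y, cdiff Y (i - 1) i y = f i x) ->
       exists x', cdiff X (i - 1) i x' = x) /\
    (forall y : Y i, cdiff Y i (i + 1) y = 0 ->
       exists x : X i, cdiff X i (i + 1) x = 0 /\
         exists y', y = f i x + cdiff Y (i - 1) i y').

Lemma quasi_iso_id X : quasi_iso (cm_id X).
Proof.
move=> i; split=> // y dy; exists y; split=> //.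
by exists 0; rewrite linear0 addr0.
Qed.

Lemma quasi_iso_comp X Y Z (g : chain_map Y Z) (f : chain_map X Y) :
  quasi_iso g -> quasi_iso f -> quasi_iso (cm_comp g f).
Proof.
move=> qg qf i; have [ig sg] := qg i; have [if_ sf] := qf i; split.
  move=> x dx bx; apply: if_ => //; apply: ig => //.
  by rewrite -cmapP dx linear0.
move=> z /sg[y [/sf[x [dx [y' ->]]] [z' ->]]]; exists x; split=> //.
by exists (g (i - 1) y' + z'); rewrite !linearD /= cmapP addrA.
Qed.

(* D^b(R-mod), for R left coherent, is the localization of K^b(R-mod) at the
   quasi-isomorphisms: a morphism X -> Y is a roof X <- apex -> Y of bounded
   complexes of finitely presented modules, up to [roof_eq]. *)
Definition bounded_fp X : Prop := bounded X /\ forall i, fin_pres (X i).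

Record roof X Y := Roof {
  apex : cochain R;
  apex_fp : bounded_fp apex;
  back : chain_map apex X;
  forth : chain_map apex Y;
  back_qis : quasi_iso back
}.

Definition roof_eq X Y (p q : roof X Y) : Prop :=
  exists (W : cochain R) (a : chain_map W (apex p)) (b : chain_map W (apex q)),
    bounded_fp W /\
    [/\ quasi_iso (cm_comp (back p) a),
        homotopic (cm_comp (back p) a) (cm_comp (back q) b) &
        homotopic (cm_comp (forth p) a) (cm_comp (forth q) b)].

Definition roof_id X (fpX : bounded_fp X) : roof X X :=
  Roof fpX (cm_id X) (quasi_iso_id X).

Definition is_roof_comp X Y Z (p : roof X Y) (q : roof Y Z) (r : roof X Z) :
    Prop :=
  exists (W : cochain R) (fpW : bounded_fp W) (a : chain_map W (apex p))
         (b : chain_map W (apex q)) (qa : quasi_iso a),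
    homotopic (cm_comp (forth p) a) (cm_comp (back q) b) /\
    roof_eq (Roof fpW (cm_comp (forth q) b)
               (quasi_iso_comp (back_qis p) qa)) r.

Definition Db_iso X Y : Prop :=
  exists (fpX : bounded_fp X) (fpY : bounded_fp Y) (p : roof X Y)
         (q : roof Y X),
    is_roof_comp p q (roof_id fpX) /\ is_roof_comp q p (roof_id fpY).

(* K^b(R-proj) = D^b(R-mod): every object of D^b(R-mod) is isomorphic there
   to a bounded complex of finitely generated projective modules. *)
Definition Kb_proj_eq_Db_mod : Prop :=
  forall X, bounded_fp X ->
    exists P, [/\ bounded P, forall i, fg_proj (P i) & Db_iso X P].

End Complexes.

(* Main.v *)
From HB Require Import structures.
Require Import Defs.
From mathcomp Require Import all_boot all_order all_algebra.
From mathcomp Require Import boolp functions zify.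

(** A bounded t-structure on a category [T] of complexes with
    K^b(R-proj) <= T <= K^{-,b}(R-proj) is squeezed between two shifts of the
    standard one, and this is what makes all of them equivalent.  By
    boundedness the regular module, seen as a complex, lies in some shift of
    the aisle and in some shift of the coaisle.

    - Since maps from shifts of [R] compute cohomology, the former makes every
      object of the coaisle acyclic below a fixed degree
      ([coaisle_acyclic]).  A complex of [T] that is acyclic above a suitable
      degree then has no maps to the coaisle ([Kmb_proj_null]), so it lies in
      the aisle ([aisle_of_acyclic]).
    - Since maps to shifts of [R] compute the cohomology of the dual complex
      Hom(-, R) of right modules, the latter makes the dual of every object
      [U] of the aisle exact above a fixed degree.  The dual of a bounded above
      complex is bounded on the other side, so beyond that degree it is a
      finite resolution, by finitely generated projectives, of a right module.
      That module has projective dimension at most [findim R^c], hence the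
      resolution splits a fixed number of steps later; finitely generated
      projectives being reflexive, the splitting can be transported back, and
      [U] is acyclic above a fixed degree ([findim_acyclic],
      [aisle_acyclic]).

    Suppose now that K^b(R-proj) carries a bounded t-structure, and let [X] be
    a complex of K^{-,b}(R-proj), with brutal truncation [P] in degrees [>= b]
    for [b] very small.  The two bounds above allow one to compare [X] with the
    third term of the truncation triangle [U -> P -> V] of [P]: the map from
    [U] to [X] vanishes, so that [P -> X] factors through [V], and [P -> V]
    extends to [X].  The composite [X -> V -> X] is the identity, and [X] is a
    summand of the perfect complex [V] ([Kmb_proj_sub_Kb]).

    Over a left coherent ring, bounded complexes of finitely presented modules
    have resolutions in K^{-,b}(R-proj) ([coherent_resolution]), which turns the
    equality of K^b(R-proj) and K^{-,b}(R-proj) into that of K^b(R-proj) and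
    D^b(R-mod).  Conversely, if the latter two agree, then the canonical
    truncations of perfect complexes are again perfect, and the standard
    t-structure restricts to K^b(R-proj) ([has_standard_t_structure]).

    The chain maps and homotopies that these arguments need all come from one
    recursion, [descend], which goes from projective to exact sequences one
    degree at a time. *)

Set Implicit Arguments.
Unset Strict Implicit.
Unset Printing Implicit Defensive.

Import Order.TTheory GRing.Theory Num.Theory.
Local Open Scope ring_scope.

Definition lin (R : pzRingType) (A B : lmodType R) (f : A -> B)
    (f_lin : linear f) : {linear A -> B} :=
  HB.pack f (GRing.isLinear.Build R A B *:%R f f_lin).

(** * Submodules *)

(** Kernels, images, truncations and dual modules are all formed as types of
    elements of a submodule; its predicate takes values in [Prop], and
    excluded middle makes [sub_of] a module with decidable equality. *)
Record submodule (R : pzRingType) (M : lmodType R) := Submodule {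
  in_sub :> M -> Prop;
  sub_closed0 : in_sub 0;
  sub_closedP : forall a x y, in_sub x -> in_sub y -> in_sub (a *: x + y)
}.

Section SubmoduleType.
Variables (R : pzRingType) (M : lmodType R) (S : submodule M).

Definition sub_pred : {pred M} := fun x => `[< S x >].

Record sub_of := SubOf { sub_val : M; _ : sub_val \in sub_pred }.

Fact sub_pred_closed : GRing.subsemimod_closed sub_pred.
Proof.
have S0 : S 0 := sub_closed0 S.
split; first split.
- exact/asboolP.
- move=> x y /asboolP Sx /asboolP Sy; apply/asboolP.
  by rewrite -(scale1r x); apply: sub_closedP.
- move=> a x /asboolP Sx; apply/asboolP.
  by rewrite -(addr0 (a *: x)); apply: sub_closedP.
Qed.

HB.instance Definition _ := [isSub for sub_val].
HB.instance Definition _ := [Choice of sub_of by <:].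
HB.instance Definition _ :=
  GRing.SubChoice_isSubLmodule.Build R M sub_pred sub_of sub_pred_closed.
End SubmoduleType.

Section Submodules.
Variable R : pzRingType.
Implicit Types A B C M N P : lmodType R.

Lemma subP M (S : submodule M) (x : sub_of S) : S (val x).
Proof. by apply/asboolP; exact: (valP x). Qed.

Definition mksub M (S : submodule M) x (Sx : S x) : sub_of S :=
  SubOf (introT (asboolP (S x)) Sx).

Section Corestriction.
Variables (A M : lmodType R) (S : submodule M) (f : {linear A -> M}).
Hypothesis fS : forall x, S (f x).

Fact corestrict_linear : linear (fun x => mksub (fS x)).
Proof.
move=> a x y; apply: val_inj.
by rewrite [RHS](linearP (val : {linear sub_of S -> M})) /= linearP.
Qed.

Definition corestrict : {linear A -> sub_of S} := lin corestrict_linear.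

Lemma corestrictE x : val (corestrict x) = f x. Proof. by []. Qed.
End Corestriction.

Fact image_closed0 A B (f : {linear A -> B}) : exists x, f x = 0.
Proof. by exists 0; rewrite linear0. Qed.

Fact image_closedP A B (f : {linear A -> B}) a y z :
  (exists x, f x = y) -> (exists x, f x = z) -> exists x, f x = a *: y + z.
Proof. by move=> [x <-] [x' <-]; exists (a *: x + x'); rewrite linearP. Qed.

Definition image_sub A B (f : {linear A -> B}) : submodule B :=
  Submodule (image_closed0 f) (@image_closedP A B f).

Fact kernel_closedP A B (f : {linear A -> B}) a x y :
  f x = 0 -> f y = 0 -> f (a *: x + y) = 0.
Proof. by move=> fx fy; rewrite linearP fx fy scaler0 addr0. Qed.

Definition kernel_sub A B (f : {linear A -> B}) : submodule A :=
  Submodule (linear0 f) (@kernel_closedP A B f).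

(** * Projective, finitely generated and finitely presented modules *)

Lemma projective_lift A B C (g : {linear B -> C}) (f : {linear A -> C}) :
  projective A -> (forall x, exists y, g y = f x) ->
  exists h : {linear A -> B}, forall x, g (h x) = f x.
Proof.
move=> projA fg.
have [|h hP] := projA B _ (@corestrict _ _ (image_sub g) g
   (fun x => ex_intro _ x erefl)) (@corestrict _ _ (image_sub g) f fg).
  by move=> y; have [x xy] := subP y; exists x; apply: val_inj.
by exists h => x; have /(congr1 val) := hP x.
Qed.

Lemma projective_retract A B (i : {linear A -> B}) (p : {linear B -> A}) :
  (forall x, p (i x) = x) -> projective B -> projective A.
Proof.
move=> pK projB C D g f g_surj; have [h hP] := projB C D g (f \o p) g_surj.
by exists (h \o i) => x; rewrite /= hP /= pK.
Qed.

Lemma fin_gen_image A B (p : {linear A -> B}) :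
  (forall y, exists x, p x = y) -> fin_gen A -> fin_gen B.
Proof.
move=> p_surj [n [q q_surj]]; exists n, (p \o q) => y.
by have [x <-] := p_surj y; have [z <-] := q_surj x; exists z.
Qed.

Lemma fg_proj_retract A B (i : {linear A -> B}) (p : {linear B -> A}) :
  (forall x, p (i x) = x) -> fg_proj B -> fg_proj A.
Proof.
move=> pK [fgB projB]; split; last exact: projective_retract pK projB.
by apply: fin_gen_image fgB => y; exists (i y).
Qed.

Lemma fg_proj_iso A B (i : {linear A -> B}) :
  injective i -> (forall y, exists x, i x = y) -> fg_proj B -> fg_proj A.
Proof.
move=> i_inj i_surj projB.
have [p pP] := projective_lift (f := idfun) projB.2 i_surj.
by apply: (fg_proj_retract (p := p)) projB => x; apply: i_inj; rewrite pP.
Qed.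

Section RowMap.
Variables (n : nat) (M : lmodType R) (v : 'I_n -> M).

Fact row_map_linear : linear (fun x : 'rV[R]_n => \sum_i x 0 i *: v i).
Proof.
move=> a x y; rewrite scaler_sumr -big_split; apply: eq_bigr => i _.
by rewrite !mxE scalerDl scalerA.
Qed.

Definition row_map : {linear 'rV[R]_n -> M} := lin row_map_linear.

End RowMap.

Lemma linear_row_sum n M (f : {linear 'rV[R]_n -> M}) x :
  f x = \sum_i x 0 i *: f (delta_mx 0 i).
Proof.
by rewrite {1}[x]row_sum_delta linear_sum; apply: eq_bigr => i _; rewrite linearZ.
Qed.

Lemma fg_proj_row n : fg_proj 'rV[R]_n.
Proof.
split; first by exists n, idfun => x; exists x.
move=> A B g f g_surj.
have /choice[v vP] : forall i : 'I_n, exists a, g a = f (delta_mx 0 i).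
  by move=> i; apply: g_surj.
exists (row_map v) => x; rewrite (linear_row_sum f) linear_sum.
by apply: eq_bigr => i _; rewrite linearZ vP.
Qed.

Lemma fg_proj_split P : fg_proj P ->
  exists n (i : {linear P -> 'rV[R]_n}) (p : {linear 'rV[R]_n -> P}),
    forall x, p (i x) = x.
Proof.
move=> [[n [p p_surj]] projP].
have [i iP] := projective_lift (f := idfun) projP p_surj.
by exists n, i, p.
Qed.

Lemma fg_proj0 A : (forall x : A, x = 0) -> fg_proj A.
Proof.
move=> A0; apply: (fg_proj_retract (B := 'rV[R]_0) (i := \0) (p := \0)).
  by move=> x; rewrite [RHS]A0.
exact: fg_proj_row.
Qed.

Section Pairing.
Variables (A B C : lmodType R) (f : {linear C -> A}) (g : {linear C -> B}).
Fact pair_map_linear : linear (fun x => (f x, g x) : (A * B)%type).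
Proof. by move=> a x y; rewrite !linearP. Qed.
Definition pair_map : {linear C -> (A * B)%type} := lin pair_map_linear.
End Pairing.

Lemma fg_proj_prod A B : fg_proj A -> fg_proj B -> fg_proj (A * B)%type.
Proof.
move=> /fg_proj_split[m [i [p pK]]] /fg_proj_split[n [j [q qK]]].
have rowP : linear (fun u : ('rV[R]_m * 'rV[R]_n)%type => row_mx u.1 u.2).
  by move=> a x y; rewrite scale_row_mx add_row_mx.
apply: (fg_proj_retract (B := 'rV[R]_(m + n))
   (i := lin rowP \o pair_map (i \o fst) (j \o snd))
   (p := pair_map (p \o lsubmx) (q \o rsubmx))).
  by move=> [x y] /=; rewrite row_mxKl row_mxKr pK qK.
exact: fg_proj_row.
Qed.

Lemma fg_proj_pres P : fg_proj P -> fin_pres P.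
Proof.
move=> /fg_proj_split[n [i [p pK]]].
exists n, n, (idfun \- (i \o p)), p; split=> [x | x]; first by exists (i x).
split=> [px | [y <-]]; first by exists x; rewrite /= px linear0 subr0.
by rewrite linearB /= pK subrr.
Qed.

End Submodules.

(** * Kernels over a coherent ring *)

Section Coherent.
Variable R : pzRingType.
Implicit Types A B I M : lmodType R.

(** Schanuel's argument: with [q] the given presentation and [a], [b] the lifts
    of [p] and [q] through each other, the kernel of [p] is generated by the
    image of [1 - b a] and by [b] applied to the relations of [q]. *)
Lemma fin_pres_kernel I m (p : {linear 'rV[R]_m -> I}) :
  fin_pres I -> (forall y, exists x, p x = y) ->
  exists l (g : {linear 'rV[R]_l -> 'rV[R]_m}),
    forall x, p x = 0 <-> exists y, g y = x.
Proof.
move=> [r [n [g [q [q_surj q_ker]]]]] p_surj.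
have [a aP] := projective_lift (fg_proj_row R m).2 (fun x => q_surj (p x)).
have [b bP] := projective_lift (fg_proj_row R n).2 (fun x => p_surj (q x)).
exists (m + r)%N, (((idfun \- (b \o a)) \o lsubmx) \+ ((b \o g) \o rsubmx)) => x.
split=> [px | [y <-]].
  have /q_ker[y gy] : q (a x) = 0 by rewrite aP.
  by exists (row_mx x y); rewrite /= row_mxKl row_mxKr gy subrK.
rewrite linearD linearB /= !bP aP subrr add0r.
by apply/q_ker; exists (rsubmx y).
Qed.

Hypothesis cohR : left_coherent R.

(** Induction on [n]: the last coordinate maps the source onto a finitely
    generated left ideal, whose relations are finitely generated by coherence;
    on these relations the remaining coordinates are considered. *)
Lemma coherent_row_kernel n m (f : {linear 'rV[R]_m -> 'rV[R]_n}) :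
  exists l (g : {linear 'rV[R]_l -> 'rV[R]_m}),
    forall x, f x = 0 <-> exists y, g y = x.
Proof.
elim: n m f => [|n IHn] m f.
  exists m, idfun => x; split=> _; first by exists x.
  by apply/rowP => -[].
have coordP : linear (fun x => f x 0 ord0 : R^o).
  by move=> a x y; rewrite linearP !mxE.
pose e : {linear 'rV[R]_m -> R^o} := lin coordP.
pose p := @corestrict _ _ _ (image_sub e) e (fun x => ex_intro _ x erefl).
have p_surj y : exists x, p x = y.
  by have [x xy] := subP y; exists x; apply: val_inj.
have fgI : fin_gen (sub_of (image_sub e)) by exists m, p.
have /fin_pres_kernel/(_ p_surj)[l [g gP]] :=
  cohR (i := (val : {linear sub_of (image_sub e) -> R^o})) val_inj fgI.
have tailP : linear (fun x : 'rV[R]_n.+1 => \row_(j < n) x 0 (lift ord0 j)).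
  by move=> a x y; apply/rowP => j; rewrite !mxE.
have [k [h hP]] := IHn l (lin tailP \o (f \o g)).
exists k, (g \o h) => x; split=> [fx | [y <-]].
  have /gP[y gy] : p x = 0 by apply: val_inj; rewrite /= fx mxE.
  have /hP[z zy] : (lin tailP \o (f \o g)) y = 0.
    by apply/rowP => j; rewrite /= gy fx !mxE.
  by exists z; rewrite /= zy.
have /gP/(congr1 val) /= e0 : exists z, g z = g (h y) by exists (h y).
have /hP/rowP e1 : exists z, h z = h y by exists y.
apply/rowP => j; rewrite mxE; have [j' ->|->] := unliftP ord0 j; last exact: e0.
by have := e1 j'; rewrite !mxE.
Qed.

(** The elements of a presentation of [A] that [f] kills are, after lifting [f]
    to the free modules, those whose image is a relation of [B]; such pairs
    form the kernel of a map of free modules. *)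
Lemma coherent_kernel A B (f : {linear A -> B}) :
  fin_gen A -> fin_pres B -> fin_gen (sub_of (kernel_sub f)).
Proof.
move=> [m [p p_surj]] [c [n [g [q [q_surj q_ker]]]]].
have [F FP] := projective_lift (f := f \o p) (fg_proj_row R m).2 (fun x => q_surj _).
have [l [h hP]] := coherent_row_kernel ((F \o lsubmx) \- (g \o rsubmx)).
have kP x : kernel_sub f ((p \o (lsubmx \o h)) x).
  have /hP/eqP : exists y, h y = h x by exists x.
  rewrite /= subr_eq0 => /eqP e; have /= <- := FP (lsubmx (h x)); rewrite e; apply/q_ker.
  by exists (rsubmx (h x)).
exists l, (corestrict kP) => y; have fy := subP y.
have [x xy] := p_surj (val y).
have /q_ker[z zx] : q (F x) = 0 by rewrite FP /= xy.
have /hP[w wP] : ((F \o lsubmx) \- (g \o rsubmx)) (row_mx x z) = 0.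
  by rewrite /= row_mxKl row_mxKr zx subrr.
by exists w; apply: val_inj; rewrite corestrictE /= wP row_mxKl.
Qed.

Lemma coherent_kernel_pres A B (f : {linear A -> B}) :
  fin_pres A -> fin_pres B -> fin_pres (sub_of (kernel_sub f)).
Proof.
move=> presA presB; have fgA : fin_gen A.
  by case: presA => [m [n [g [p [p_surj _]]]]]; exists n, p.
have [n [p p_surj]] := coherent_kernel f fgA presB.
have [m [g g_surj]] := coherent_kernel
  ((val : {linear sub_of (kernel_sub f) -> A}) \o p) (fg_proj_row R n).1 presA.
exists m, n, (val \o g), p; split=> // x; split=> [px | [y <-]].
  have kx : kernel_sub ((val : {linear sub_of (kernel_sub f) -> A}) \o p) x.
    exact: etrans (congr1 val px) (linear0 _).
  by have [y yx] := g_surj (mksub kx); exists y; rewrite /= yx.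
by apply: val_inj; rewrite linear0; apply: (subP (g y)).
Qed.

Lemma fin_pres_prod A B : fin_pres A -> fin_pres B -> fin_pres (A * B)%type.
Proof.
move=> [m [n [g [p [p_surj p_ker]]]]] [m' [n' [g' [p' [p'_surj p'_ker]]]]].
have rowP : linear (fun u : ('rV[R]_n * 'rV[R]_n')%type => row_mx u.1 u.2).
  by move=> a x y; rewrite scale_row_mx add_row_mx.
exists (m + m')%N, (n + n')%N, (lin rowP \o pair_map (g \o lsubmx) (g' \o rsubmx)),
  (pair_map (p \o lsubmx) (p' \o rsubmx)).
split=> [[y y'] | x].
  have [x xy] := p_surj y; have [x' xy'] := p'_surj y'.
  by exists (row_mx x x'); rewrite /= row_mxKl row_mxKr xy xy'.
split=> [[/p_ker[y yx] /p'_ker[y' yx']] | [y <-]].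
  by exists (row_mx y y'); rewrite /= row_mxKl row_mxKr yx yx' hsubmxK.
rewrite /= row_mxKl row_mxKr; congr pair.
  by apply/p_ker; exists (lsubmx y).
by apply/p'_ker; exists (rsubmx y).
Qed.

End Coherent.

(** * Lifting along exact sequences *)

(** Degrees such as [i + 1 - 1] and [i] are equal but not convertible.  Making
    [transport] total, and zero between different degrees, keeps equality
    proofs out of the terms, so that it can be rewritten without dependent
    matching. *)
Section Transport.
Variables (R : pzRingType) (I : eqType) (F : I -> lmodType R).

Definition transport (i j : I) : {linear F i -> F j} :=
  if @eqP _ i j is ReflectT e
  then ecast k {linear F i -> F k} e (idfun : {linear F i -> F i})
  else \0 : {linear F i -> F j}.

Lemma transport_id i x : transport i i x = x.
Proof. by rewrite /transport; case: eqP => // e; rewrite (eq_irrelevance e erefl). Qed.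

Lemma transport_ne i j x : i != j -> transport i j x = 0.
Proof. by rewrite /transport; case: eqP. Qed.

Lemma transportK i j x : i = j -> transport j i (transport i j x) = x.
Proof. by move=> e; case: _ / e; rewrite !transport_id. Qed.
End Transport.

Section Descend.
Variables (R : pzRingType) (A B : nat -> lmodType R).
Variables (dA : forall k, {linear A k.+1 -> A k}).
Variables (dB : forall k, {linear B k.+1 -> B k}).
Variables (c : forall k, {linear A k.+1 -> B k}) (phi0 : {linear A 0%N -> B 0%N}).
Hypothesis projA : forall k, projective (A k.+1).
Hypothesis dAK : forall k x, dA k (dA k.+1 x) = 0.
Hypothesis cP : forall k x, dB k (c k.+1 x) = c k (dA k.+1 x).
Hypothesis phi0P : forall x, exists z, dB 0 z = c 0 x - phi0 (dA 0 x).

Let solves k (f : {linear A k -> B k}) (g : {linear A k.+1 -> B k.+1}) :=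
  forall x, dB k (g x) = c k x - f (dA k x).

Let next k (f : {linear A k -> B k}) : {linear A k.+1 -> B k.+1} :=
  if pselect (exists g, solves f g) is left ex then sval (cid ex) else \0.

Let phi := fix phi k : {linear A k -> B k} :=
  if k is k'.+1 then next (phi k') else phi0.

(** Each step lifts [c k - psi k dA] through [dB k], which is possible because
    this map lands in the cycles.  One recursion serves all comparison arguments
    of homological algebra: lifts of maps along resolutions ([c = 0]) and
    homotopies ([c] the map to be contracted).  The equation in degree [k]
    depends on exactness only up to [k]. *)
Lemma descend : exists psi : forall k, {linear A k -> B k},
  psi 0 = phi0 /\
  forall k, (forall j, (j < k)%N -> forall y, dB j y = 0 -> exists z, dB j.+1 z = y) ->
    forall x, dB k (psi k.+1 x) = c k x - psi k (dA k x).
Proof.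
exists phi; split=> //; elim=> [|k IHk] exactB.
  rewrite /= /next; case: pselect => [ex | []]; first by case: cid.
  have [g gP] := projective_lift
    (f := c 0%N \- (phi0 \o dA 0%N)) (@projA 0%N) phi0P.
  by exists g.
have {}IHk := IHk (fun j lt_jk => exactB j (ltnW lt_jk)).
rewrite /= /next; case: pselect => [ex | []]; first by case: cid.
have [|g gP] := projective_lift (g := dB k.+1)
    (f := c k.+1 \- (phi k.+1 \o dA k.+1)) (@projA k.+1).
  move=> x; apply: exactB => //; rewrite /= linearB /= cP [X in _ - X]IHk.
  by rewrite dAK linear0 subr0 subrr.
by exists g.
Qed.
End Descend.

(** * The homotopy category *)

Section Homotopy.
Variable R : pzRingType.
Implicit Types (X Y Z W : cochain R) (i j k n m : int).

(** The next lemmas restate conditions written with [i - 1], [i] and [i + 1]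
    for arbitrary indices related by equations. *)
Lemma acyclic_lift X i j k (x : X j) : acyclic_at X j ->
  j = i + 1 -> k = j + 1 -> cdiff X j k x = 0 -> exists y, cdiff X i j y = x.
Proof.
move=> acX ji kj; have ij : i = j - 1 by lia.
by subst i; subst k; apply: acX.
Qed.

Lemma acyclicI X i j k : j = i + 1 -> k = j + 1 ->
  (forall x : X j, cdiff X j k x = 0 -> exists y, cdiff X i j y = x) ->
  acyclic_at X j.
Proof.
move=> ji kj; have ij : i = j - 1 by lia.
by subst i; subst k.
Qed.

Lemma acyclic_zero X i : (forall x : X i, x = 0) -> acyclic_at X i.
Proof. by move=> X0 x _; exists 0; rewrite linear0 [RHS]X0. Qed.

Definition contracts_at X Y (f : chain_map X Y)
    (h : forall i j, {linear X i -> Y j}) i :=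
  forall x, f i x = cdiff Y (i - 1) i (h i (i - 1) x)
                  + h (i + 1) i (cdiff X i (i + 1) x).

Lemma contracts_atE X Y (f : chain_map X Y)
    (h : forall i j, {linear X i -> Y j}) i j k x :
  contracts_at f h j -> j = i + 1 -> k = j + 1 ->
  f j x = cdiff Y i j (h j i x) + h k j (cdiff X j k x).
Proof.
move=> hf ji kj; have ij : i = j - 1 by lia.
by subst i; subst k; apply: hf.
Qed.

Lemma contracts_atI X Y (f : chain_map X Y)
    (h : forall i j, {linear X i -> Y j}) i j k :
  j = i + 1 -> k = j + 1 ->
  (forall x, f j x = cdiff Y i j (h j i x) + h k j (cdiff X j k x)) ->
  contracts_at f h j.
Proof.
move=> ji kj; have ij : i = j - 1 by lia.
by subst i; subst k.
Qed.

Section ChainMapI.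
Variables (X Y : cochain R) (f : forall i, {linear X i -> Y i}).
Hypothesis fP : forall i j, j = i + 1 ->
  forall x, f j (cdiff X i j x) = cdiff Y i j (f i x).
Fact chain_map_commutes i j x : f j (cdiff X i j x) = cdiff Y i j (f i x).
Proof.
have [/fP-> // | ne_ji] := eqVneq j (i + 1).
by rewrite !(cdiff_eq0 ne_ji) linear0.
Qed.
Definition chain_mapI := ChainMap chain_map_commutes.
End ChainMapI.

Definition cm_zero X Y : chain_map X Y :=
  @chain_mapI X Y (fun i => \0) (fun i j _ x => esym (linear0 _)).

Section Sub.
Variables (X Y : cochain R) (f g : chain_map X Y).
Fact cm_sub_proof i j (_ : j = i + 1) x :
  (f j \- g j : {linear X j -> Y j}) (cdiff X i j x)
  = cdiff Y i j ((f i \- g i : {linear X i -> Y i}) x).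
Proof. by rewrite /= !cmapP linearB. Qed.
Definition cm_sub := chain_mapI cm_sub_proof.
End Sub.

Lemma homotopic_pointwise X Y (f g : chain_map X Y) :
  (forall i x, f i x = g i x) -> homotopic f g.
Proof.
move=> fg; exists (fun i j => \0) => i x.
by rewrite fg subrr /= linear0 addr0.
Qed.

Lemma homotopic_sym X Y (f g : chain_map X Y) : homotopic f g -> homotopic g f.
Proof.
move=> [h hP]; exists (fun i j => \- h i j) => i x.
by rewrite -opprB hP /= linearN opprD.
Qed.

Lemma homotopic_trans X Y (g f k : chain_map X Y) :
  homotopic f g -> homotopic g k -> homotopic f k.
Proof.
move=> [h hP] [h' h'P]; exists (fun i j => h i j \+ h' i j) => i x.
by rewrite -(subrK (g i x) (f i x)) -addrA hP h'P /= linearD addrACA.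
Qed.

Lemma homotopic_compl X Y Z (k : chain_map Y Z) (f g : chain_map X Y) :
  homotopic f g -> homotopic (cm_comp k f) (cm_comp k g).
Proof.
move=> [h hP]; exists (fun i j => k j \o h i j) => i x.
by rewrite /= -linearB hP linearD cmapP.
Qed.

Lemma homotopic_compr X Y Z (k : chain_map X Y) (f g : chain_map Y Z) :
  homotopic f g -> homotopic (cm_comp f k) (cm_comp g k).
Proof.
move=> [h hP]; exists (fun i j => h i j \o k i) => i x.
by rewrite /= hP cmapP.
Qed.

Lemma null_homotopicE X Y (f : chain_map X Y) :
  null_homotopic f <-> homotopic f (cm_zero X Y).
Proof.
split=> -[h hP]; exists h => i x; first by rewrite subr0 hP.
by rewrite -hP subr0.
Qed.

Lemma null_homotopic_eq X Y (f g : chain_map X Y) :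
  homotopic f g -> null_homotopic g -> null_homotopic f.
Proof.
by move=> fg /null_homotopicE g0; apply/null_homotopicE; apply: homotopic_trans g0.
Qed.

Lemma null_homotopic_compl X Y Z (k : chain_map Y Z) (f : chain_map X Y) :
  null_homotopic f -> null_homotopic (cm_comp k f).
Proof.
move=> /null_homotopicE/(homotopic_compl k) f0; apply/null_homotopicE.
apply: homotopic_trans f0 _.
by apply: homotopic_pointwise => i x /=; rewrite linear0.
Qed.

Lemma null_homotopic_compr X Y Z (k : chain_map X Y) (f : chain_map Y Z) :
  null_homotopic f -> null_homotopic (cm_comp f k).
Proof.
move=> /null_homotopicE/(homotopic_compr k) f0; apply/null_homotopicE.
by apply: homotopic_trans f0 _; apply: homotopic_pointwise.
Qed.

Lemma homotopic_comp1 X Y (f : chain_map X Y) (e : chain_map Y Y) :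
  homotopic e (cm_id Y) -> homotopic (cm_comp e f) f.
Proof.
move=> /(homotopic_compr f) e1; apply: homotopic_trans e1 _.
exact: homotopic_pointwise.
Qed.

Lemma homotopic_1comp X Y (f : chain_map X Y) (e : chain_map X X) :
  homotopic e (cm_id X) -> homotopic (cm_comp f e) f.
Proof.
move=> /(homotopic_compl f) e1; apply: homotopic_trans e1 _.
exact: homotopic_pointwise.
Qed.

Lemma homotopic_compA X Y Z W (f : chain_map X Y) (g : chain_map Y Z)
    (k : chain_map Z W) :
  homotopic (cm_comp k (cm_comp g f)) (cm_comp (cm_comp k g) f).
Proof. exact: homotopic_pointwise. Qed.

Lemma hiso_refl X : hiso X X.
Proof. by exists (cm_id X), (cm_id X); split; apply: homotopic_pointwise. Qed.

Lemma hiso_sym X Y : hiso X Y -> hiso Y X.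
Proof. by move=> [f [g [gf fg]]]; exists g, f. Qed.

Lemma hequiv_comp X Y Z (f : chain_map X Y) (g : chain_map Y Z) :
  hequiv f -> hequiv g -> hequiv (cm_comp g f).
Proof.
move=> [f' [f'f ff']] [g' [g'g gg']]; exists (cm_comp f' g'); split.
  apply: homotopic_trans f'f.
  apply: homotopic_trans (homotopic_compl f' (homotopic_comp1 f g'g)).
  exact: homotopic_pointwise.
apply: homotopic_trans gg'.
apply: homotopic_trans (homotopic_compl g (homotopic_comp1 g' ff')).
exact: homotopic_pointwise.
Qed.

Lemma hiso_trans X Y Z : hiso X Y -> hiso Y Z -> hiso X Z.
Proof. by move=> [f f_eq] [g g_eq]; exists (cm_comp g f); apply: hequiv_comp. Qed.

Lemma hiso_strict X Y (f : chain_map X Y) (g : chain_map Y X) :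
  (forall i, cancel (f i) (g i)) -> (forall i, cancel (g i) (f i)) -> hiso X Y.
Proof.
move=> fK gK; exists f, g; split; apply: homotopic_pointwise => i x.
  exact: fK.
exact: gK.
Qed.

Lemma null_homotopic_hiso X X' Y Y' : hiso X X' -> hiso Y Y' ->
  (forall f : chain_map X' Y', null_homotopic f) ->
  forall f : chain_map X Y, null_homotopic f.
Proof.
move=> [a [a' [a'a _]]] [b [b' [b'b _]]] null f.
apply: (null_homotopic_eq (g := cm_comp b' (cm_comp (cm_comp b (cm_comp f a')) a))).
  apply: (homotopic_trans (g := cm_comp (cm_comp b' b) f)).
    exact/homotopic_sym/homotopic_comp1.
  apply: (homotopic_trans (g := cm_comp (cm_comp (cm_comp b' b) f) (cm_comp a' a))).
    exact/homotopic_sym/homotopic_1comp.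
  exact: homotopic_pointwise.
exact/null_homotopic_compl/null_homotopic_compr.
Qed.

Lemma acyclic_retract X Y i (f : chain_map X Y) (g : chain_map Y X) :
  homotopic (cm_comp g f) (cm_id X) -> acyclic_at Y i -> acyclic_at X i.
Proof.
move=> [h hP] acY x dx.
have [|y yP] := acY (f i x); first by rewrite -cmapP dx linear0.
have := hP i x; rewrite /= dx linear0 addr0 => e.
exists (g (i - 1) y - h i (i - 1) x).
by rewrite linearB -e -cmapP yP subKr.
Qed.

Lemma acyclic_hiso X Y i : hiso X Y -> acyclic_at Y i -> acyclic_at X i.
Proof. by move=> [f [g [gf _]]]; apply: acyclic_retract gf. Qed.

(** ** Shifts *)

Lemma transport_cmap X Y (f : chain_map X Y) i j x :
  f j (transport X i j x) = transport Y i j (f i x).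
Proof.
have [e|ne] := eqVneq i j; first by case: _ / e; rewrite !transport_id.
by rewrite !transport_ne ?linear0.
Qed.

Lemma transport_cdiff X i i' j j' x : i = i' -> j = j' ->
  transport X j j' (cdiff X i j x) = cdiff X i' j' (transport X i i' x).
Proof. by move=> ei ej; case: _ / ei; case: _ / ej; rewrite !transport_id. Qed.

Lemma odd_absD n m : odd `|(n + m)%R|%N = odd `|n|%N (+) odd `|m|%N.
Proof. lia. Qed.

Lemma shift_shift n m X : hiso (shift n (shift m X)) (shift (n + m) X).
Proof.
pose F i : {linear shift n (shift m X) i -> shift (n + m) X i} :=
  transport X (i + n + m) (i + (n + m)).
pose G i : {linear shift (n + m) X i -> shift n (shift m X) i} :=
  transport X (i + (n + m)) (i + n + m).
have FP i j : j = i + 1 -> forall x, F j (cdiff _ i j x) = cdiff _ i j (F i x).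
  move=> _ x; rewrite /F /= !sign_linE odd_absD; do 2!case: (odd _) => /=;
  by rewrite ?linearN ?opprK (transport_cdiff (i' := i + (n + m)) (j' := j + (n + m))) ?addrA.
have GP i j : j = i + 1 -> forall x, G j (cdiff _ i j x) = cdiff _ i j (G i x).
  move=> _ x; rewrite /G /= !sign_linE odd_absD; do 2!case: (odd _) => /=;
  by rewrite ?linearN ?opprK (transport_cdiff (i' := i + n + m) (j' := j + n + m)) ?addrA.
apply: (hiso_strict (f := chain_mapI FP) (g := chain_mapI GP)) => i x.
  by rewrite /= /F /G transportK ?addrA.
by rewrite /= /F /G transportK ?addrA.
Qed.

Lemma shift0 X : hiso (shift 0 X) X.
Proof.
pose F i : {linear shift 0 X i -> X i} := transport X (i + 0) i.
pose G i : {linear X i -> shift 0 X i} := transport X i (i + 0).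
have FP i j : j = i + 1 -> forall x, F j (cdiff _ i j x) = cdiff _ i j (F i x).
  by move=> _ x; rewrite /F /= (transport_cdiff (i' := i) (j' := j)) ?addr0.
have GP i j : j = i + 1 -> forall x, G j (cdiff _ i j x) = cdiff _ i j (G i x).
  by move=> _ x; rewrite /G /= (transport_cdiff (i' := i + 0) (j' := j + 0)) ?addr0.
apply: (hiso_strict (f := chain_mapI FP) (g := chain_mapI GP)) => i x.
  by rewrite /= /F /G transportK ?addr0.
by rewrite /= /F /G transportK ?addr0.
Qed.

Lemma shift_map_null n X Y (f : chain_map X Y) :
  null_homotopic f -> null_homotopic (shift_map n f).
Proof.
move=> [h hP]; exists (fun i j => sign_lin (odd `|n|%N) (h (i + n) (j + n))) => i x.
rewrite /= !sign_linE.
rewrite (contracts_atE (f := f) (h := h) (i := i - 1 + n) (k := i + 1 + n)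
           x (hP (i + n))); try lia.
by case: odd; rewrite ?linearN ?opprK.
Qed.

Lemma shift_map_homotopic n X Y (f g : chain_map X Y) :
  homotopic f g -> homotopic (shift_map n f) (shift_map n g).
Proof. by move=> fg; have [h hP] := @shift_map_null n X Y (cm_sub f g) fg; exists h. Qed.

Lemma shift_hiso n X Y : hiso X Y -> hiso (shift n X) (shift n Y).
Proof.
move=> [f [g [gf fg]]]; exists (shift_map n f), (shift_map n g).
split.
  apply: homotopic_trans (homotopic_trans (shift_map_homotopic n gf) _);
  exact: homotopic_pointwise.
apply: homotopic_trans (homotopic_trans (shift_map_homotopic n fg) _);
exact: homotopic_pointwise.
Qed.

(** Shifting back is the identity only up to transport, hence the conjugation
    of the homotopy by transports. *)
Lemma shift_map_null_inv n X Y (f : chain_map X Y) :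
  null_homotopic (shift_map n f) -> null_homotopic f.
Proof.
move=> [h hP].
pose h' i j : {linear X i -> Y j} := transport Y (j - n + n) j
  \o (sign_lin (odd `|n|%N) (h (i - n) (j - n)) \o transport X i (i - n + n)).
exists h' => i x; rewrite /h' /= !sign_linE.
have := contracts_atE (f := shift_map n f) (h := h) (i := i - 1 - n) (k := i + 1 - n)
  (transport X i (i - n + n) x) (hP (i - n)).
move=> /(_ ltac:(lia) ltac:(lia))/(congr1 (transport Y (i - n + n) i)).
rewrite /= !sign_linE transport_cmap transportK ?subrK // linearD => ->.
rewrite (transport_cdiff (i' := i - n + n) (j' := i + 1 - n + n)) ?subrK //.
by case: odd; rewrite ?linearN -?linearN /= (transport_cdiff (i' := i - 1) (j' := i)) ?subrK.
Qed.

Lemma acyclic_shift n X i : acyclic_at (shift n X) i <-> acyclic_at X (i + n).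
Proof.
have e : i + 1 + n = i + n + 1 by lia.
have e' : i + n = i - 1 + n + 1 by lia.
split=> acX.
  apply: (acyclicI e' e) => x dx.
  have [|y] := acX x; first by rewrite /= sign_linE dx oppr0 if_same.
  rewrite /= sign_linE; case: odd => dy; last by exists y.
  by exists (- y); rewrite linearN.
move=> x; rewrite /= sign_linE => dx.
have [|y dy] := acyclic_lift (X := X) (x := x) acX e' e.
  by move: dx; case: odd => // /eqP; rewrite oppr_eq0 => /eqP.
exists (if odd `|n|%N then - y else y); rewrite sign_linE.
by case: odd; rewrite ?linearN ?opprK.
Qed.

End Homotopy.

(** ** Subcomplexes *)

Section Subcomplex.
Variables (R : pzRingType) (X : cochain R) (S : forall i, submodule (X i)).
Hypothesis S_closed : forall i x, S i x -> S (i + 1) (cdiff X i (i + 1) x).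

Fact subcomplex_closed i j (x : sub_of (S i)) :
  S j ((cdiff X i j \o val : {linear sub_of (S i) -> X j}) x).
Proof.
have [->|ne_ji] := eqVneq j (i + 1); first exact/S_closed/subP.
by rewrite /= cdiff_eq0 //; apply: sub_closed0.
Qed.

Definition subcomplex_diff i j : {linear sub_of (S i) -> sub_of (S j)} :=
  corestrict (@subcomplex_closed i j).

Fact subcomplex_diff_eq0 i j : j != i + 1 -> forall x, subcomplex_diff i j x = 0.
Proof. by move=> ne_ji x; apply: val_inj; rewrite /= cdiff_eq0. Qed.

Fact subcomplex_diffK i j k x : subcomplex_diff j k (subcomplex_diff i j x) = 0.
Proof. by apply: val_inj; rewrite /= cdiffK. Qed.

Definition subcomplex : cochain R := Cochain subcomplex_diff_eq0 subcomplex_diffK.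

Fact subcomplex_incl_proof i j (_ : j = i + 1) x :
  (val : {linear sub_of (S j) -> X j}) (cdiff subcomplex i j x)
  = cdiff X i j ((val : {linear sub_of (S i) -> X i}) x).
Proof. by []. Qed.

Definition subcomplex_incl : chain_map subcomplex X :=
  @chain_mapI _ subcomplex X _ subcomplex_incl_proof.

End Subcomplex.

Section Cut.
Variables (R : pzRingType) (M N : lmodType R).

Fact cut_closed0 (b : bool) (g : {linear M -> N}) : if b then g 0 = 0 else (0 : M) = 0.
Proof. by case: b; rewrite ?linear0. Qed.

Fact cut_closedP (b : bool) (g : {linear M -> N}) a (x y : M) :
  (if b then g x = 0 else x = 0) -> (if b then g y = 0 else y = 0) ->
  if b then g (a *: x + y) = 0 else a *: x + y = 0.
Proof.
case: b => [gx gy|-> ->]; last by rewrite scaler0 addr0.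
by rewrite linearP gx gy scaler0 addr0.
Qed.

(** All truncations below are degreewise of this form: the kernel of [g] in
    the degrees where [b] holds, zero elsewhere. *)
Definition cut b g : submodule M := Submodule (cut_closed0 b g) (@cut_closedP b g).

Lemma cut_eq0 (b : bool) (g : {linear M -> N}) (x : sub_of (cut b g)) : ~~ b -> x = 0.
Proof. by move=> nb; apply: val_inj; move: (val x) (subP x) => y; rewrite /= (negPf nb). Qed.

Lemma fg_proj_cut (b : bool) (g : {linear M -> N}) :
  (b -> forall x, g x = 0) -> (b -> fg_proj M) ->
  fg_proj (sub_of (cut b g)).
Proof.
move=> g0 projM; have [nb|hb] := orP (orNb b).
  by apply: fg_proj0 => x; apply: cut_eq0.
apply: (fg_proj_iso (i := (val : {linear sub_of (cut b g) -> M})) _ _ (projM hb)).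
  exact: val_inj.
move=> y; have cy : cut b g y by rewrite /= hb g0.
by exists (mksub cy).
Qed.
End Cut.

Section BrutalTruncation.
Variables (R : pzRingType) (X : cochain R) (b : int).

Let S i := cut (b <= i) (\0 : {linear X i -> X i}).

Fact brutal_closed i x : S i x -> S (i + 1) (cdiff X i (i + 1) x).
Proof.
rewrite /=; case: ifP => [lebi _|_ ->]; last by rewrite linear0; case: ifP.
by rewrite (le_trans lebi) // lerDl.
Qed.

Definition brutal := subcomplex brutal_closed.
Definition brutal_incl : chain_map brutal X := subcomplex_incl brutal_closed.

Lemma brutal_eq0 i (x : brutal i) : i < b -> x = 0.
Proof. by move=> lt_ib; apply: cut_eq0; rewrite -ltNge. Qed.

Lemma fg_proj_brutal i : fg_proj (X i) -> fg_proj (brutal i).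
Proof. by move=> projX; apply: fg_proj_cut. Qed.

Section Lift.
Variable i : int.
Hypothesis lebi : b <= i.
Fact brutal_lift_proof x : S i ((idfun : {linear X i -> X i}) x).
Proof. by rewrite /= lebi. Qed.
Definition brutal_lift : {linear X i -> brutal i} := corestrict brutal_lift_proof.
End Lift.
End BrutalTruncation.

(** * Comparison of complexes *)

Section Comparison.
Variable R : pzRingType.
Implicit Types (X Y Z W : cochain R) (i j k b : int).

(** The missing part of a homotopy is constructed from degree [b] downwards by
    [descend]; each degree depends only on acyclicity of the target between it
    and [b], so that the equation may hold only down to some degree. *)
Lemma homotopy_extend X Y (f : chain_map X Y) b (h : forall i j, {linear X i -> Y j}) :
  (forall i, b <= i -> contracts_at f h i) ->
  (forall i, i < b -> projective (X i)) ->
  exists h' : forall i j, {linear X i -> Y j},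
    (forall i, b <= i -> contracts_at f h' i) /\
    (forall i, i < b -> (forall j, i <= j < b -> acyclic_at Y j) -> contracts_at f h' i).
Proof.
move=> hf projX.
have [acY|nacY] := pselect (acyclic_at Y (b - 1)); last first.
  exists h; split=> // i lt_ib acY; case: nacY; apply: acY; lia.
(* The homotopy has degree -1, hence the different offsets in [A] and [B]. *)
pose A (k : nat) := X (b - k%:Z); pose B (k : nat) := Y (b - k.+1%:Z).
have [||||psi [psi0 psiP]] := @descend R A B
    (fun k : nat => cdiff X (b - k.+1%:Z) (b - k%:Z))
    (fun k : nat => cdiff Y (b - k.+2%:Z) (b - k.+1%:Z))
    (fun k : nat => f (b - k.+1%:Z)) (h (b - 0%:Z) (b - 1%:Z)).
- by move=> k; apply: projX; lia.
- by move=> k x; apply: cdiffK.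
- by move=> k x; rewrite cmapP.
- move=> x; apply: (acyclic_lift (X := Y) (k := b - 0%:Z) acY); try lia.
  rewrite linearB /= -cmapP.
  rewrite (contracts_atE (f := f) (h := h) (i := b - 1) (k := b + 1)
            (cdiff X (b - 1) (b - 0) x) (hf (b - 0) _)); try lia.
  by rewrite cdiffK linear0 addr0 subrr.
pose h' i j : {linear X i -> Y j} := if b <= i then h i j else
  transport Y (b - (`|(b - i)%R|%N).+1%:Z) j
  \o (psi `|(b - i)%R|%N \o transport X i (b - `|(b - i)%R|%N%:Z)).
have h'E (k : nat) x : h' (b - k%:Z) (b - k.+1%:Z) x = psi k x.
  rewrite /h'; case: k x => [|k] x; first by rewrite ifT ?psi0 //; lia.
  rewrite ifN /=; last lia.
  have: k.+1 = `|(b - (b - k.+1%:Z))%R|%N by lia.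
  by move: (`|_|%N) => N eN; case: N / eN; rewrite !transport_id.
exists h'; split=> i.
  move=> lebi x; rewrite (hf i lebi x) /h' lebi ifT //; lia.
move=> lt_ib acYi; have [k ik] : exists k : nat, i = b - k.+1%:Z.
  by exists (`|(b - i)%R|%N.-1); lia.
subst i; apply: (contracts_atI (i := b - k.+2%:Z) (k := b - k%:Z)); try lia.
move=> x; rewrite !h'E psiP ?subrK // => j lt_jk y dy.
apply: (acyclic_lift (X := Y) (k := b - j.+1%:Z) (acYi _ _) _ _ dy); lia.
Qed.

(** The comparison theorem for projective resolutions, started in the middle:
    the given map plays the role of the map to be lifted. *)
Lemma chain_map_extend X Y b (g : chain_map (brutal X b) Y) :
  (forall i, i < b -> projective (X i)) ->
  (forall i, i <= b -> acyclic_at Y i) ->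
  exists f : chain_map X Y,
    forall i x, cm_comp f (brutal_incl X b) i x = g i x.
Proof.
move=> projX acY.
pose A (k : nat) := X (b - k%:Z); pose B (k : nat) := Y (b - k%:Z).
have le_b0 : b <= b - 0%:Z by lia.
have [||||psi [psi0 psiP]] := @descend R A B
    (* [descend] solves [dB psi = c - psi dA]; with [c = 0] the sign makes
       [psi] commute with the differentials. *)
    (fun k : nat => \- cdiff X (b - k.+1%:Z) (b - k%:Z))
    (fun k : nat => cdiff Y (b - k.+1%:Z) (b - k%:Z))
    (fun k : nat => \0) (g _ \o brutal_lift X le_b0).
- by move=> k; apply: projX; lia.
- by move=> k x; rewrite /= linearN opprK cdiffK.
- by move=> k x; rewrite /= linear0.
- move=> x; rewrite /= sub0r.
  set w := mksub _; have dw : cdiff (brutal X b) (b - 0%:Z) (b + 1) w = 0.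
    by apply: val_inj; rewrite /= linearN cdiffK oppr0.
  apply: (acyclic_lift (X := Y) (k := b + 1) (acY _ _)); try lia.
  have := cmapP g (i := b - 0%:Z) (b + 1) w; rewrite dw linear0 => e.
  by rewrite linearN -[X in - X]e oppr0.
pose f i : {linear X i -> Y i} := if pselect (b <= i) is left e
  then g i \o brutal_lift X e
  else transport Y (b - `|(b - i)%R|%N%:Z) i
       \o (psi `|(b - i)%R|%N \o transport X i (b - `|(b - i)%R|%N%:Z)).
have f_ge i (e : b <= i) x : f i x = g i (brutal_lift X e x).
  by rewrite /f; case: pselect => // e'; rewrite (bool_irrelevance e' e).
have f_le (k : nat) x : f (b - k%:Z) x = psi k x.
  case: k x => [|k] x.
    by rewrite psi0 (f_ge _ le_b0).
  rewrite /f; case: pselect => [|_]; first lia.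
  have: k.+1 = `|(b - (b - k.+1%:Z))%R|%N by lia.
  by rewrite /=; move: (`|_|%N) => N eN; case: N / eN; rewrite !transport_id.
have fP i j : j = i + 1 -> forall x, f j (cdiff X i j x) = cdiff Y i j (f i x).
  move=> ji x; have [lebi|lt_ib] := leP b i.
    have lebj : b <= j by lia.
    rewrite (f_ge _ lebi) (f_ge _ lebj) -cmapP; congr (g _ _).
    exact: val_inj.
  have [k ik] : exists k : nat, i = b - k.+1%:Z by exists (`|(b - i)%R|%N.-1); lia.
  have jk : j = b - k%:Z by lia.
  clear ji; subst i; subst j; rewrite !f_le psiP /= ?linearN ?opprK ?add0r //.
  move=> j' _ y dy; apply: (acyclic_lift (X := Y) (k := b - j'%:Z) (acY _ _) _ _ dy); lia.
exists (chain_mapI fP) => i x /=.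
have [lebi|lt_ib] : b <= i \/ i < b by lia.
  by rewrite (f_ge _ lebi); congr (g _ _); apply: val_inj.
by rewrite (brutal_eq0 x lt_ib) !linear0.
Qed.

Lemma contracts_at_comp X Y (f : chain_map X Y) (h : forall i j, {linear X i -> X j}) i :
  contracts_at (cm_id X) h i -> contracts_at f (fun i j => f j \o h i j) i.
Proof. by move=> hi x; rewrite /= -cmapP -linearD -hi. Qed.

(** If the source is projective, bounded above and acyclic above [a], its part
    above [a] is contractible; the contraction, followed by the map, is a
    partial homotopy that extends downwards. *)
Lemma null_homotopic_amplitude X Y (f : chain_map X Y) a :
  bounded_above X -> (forall i, projective (X i)) ->
  (forall i, a < i -> acyclic_at X i) -> (forall i, i <= a -> acyclic_at Y i) ->
  null_homotopic f.
Proof.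
move=> [t X0] projX acX acY.
case: (@homotopy_extend X X (cm_id X) (t + 1) (fun i j => \0)) => [||h [h1 h2]].
- by move=> i lt_ti x; rewrite /= linear0 addr0; apply: X0; lia.
- by move=> i _; apply: projX.
case: (@homotopy_extend X Y f (a + 1) (fun i j => f j \o h i j)) => [||h' [h'1 h'2]].
- move=> i lt_ai; apply: contracts_at_comp; have [le_ti|lt_it] := leP (t + 1) i; first exact: h1.
  by apply: h2 => // j le_ij; apply: acX; lia.
- by move=> i _; apply: projX.
exists h' => i; have [le_ai|lt_ia] := leP (a + 1) i; first exact: h'1.
by apply: h'2 => // j le_ij; apply: acY; lia.
Qed.

(** ** Mapping cones *)

Section Cone.
Variables (X Y : cochain R) (f : chain_map X Y).

Lemma cone_diffE i (z : cone f i) :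
  cdiff (cone f) i (i + 1) z
  = (- cdiff X (i + 1) (i + 1 + 1) z.1, f (i + 1) z.1 + cdiff Y i (i + 1) z.2).
Proof. by rewrite /= /cone_diff_fun cone_glueE. Qed.

Lemma cone_diff_any i j (z : cone f i) : j = i + 1 ->
  cdiff (cone f) i j z
  = (- cdiff X (i + 1) (j + 1) z.1, transport Y (i + 1) j (f (i + 1) z.1) + cdiff Y i j z.2).
Proof. by move=> ->; rewrite cone_diffE transport_id. Qed.

(** The homotopy from [g f] to zero supplies the component on [X]. *)
Lemma cone_extend W (g : chain_map Y W) :
  null_homotopic (cm_comp g f) ->
  exists g' : chain_map (cone f) W, forall i y, cm_comp g' (cone_in f) i y = g i y.
Proof.
move=> [s sP].
pose F i : {linear cone f i -> W i} := (g i \o snd) \+ (s (i + 1) i \o fst).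
have FP i j : j = i + 1 -> forall z, F j (cdiff (cone f) i j z) = cdiff W i j (F i z).
  move=> ji [x y]; subst j; rewrite cone_diffE /F /= !linearD /= !cmapP linearN /=.
  have /= -> := contracts_atE (f := cm_comp g f) (h := s) (i := i) (k := i + 1 + 1)
    x (sP (i + 1)) erefl erefl.
  by rewrite addrAC addrK addrC.
by exists (chain_mapI FP) => i y; rewrite /= /F /= linear0 addr0.
Qed.

Lemma cone_factor W (g : chain_map (cone f) W) :
  null_homotopic (cm_comp g (cone_in f)) ->
  exists k : chain_map (shift 1 X) W, homotopic g (cm_comp k (cone_out f)).
Proof.
move=> [s sP].
pose in1 i : {linear X (i + 1) -> cone f i} := pair_map idfun \0.
pose K i : {linear shift 1 X i -> W i} :=
  (g i \o in1 i) \- (s (i + 1) i \o f (i + 1)).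
have KP i j : j = i + 1 -> forall x, K j (cdiff (shift 1 X) i j x) = cdiff W i j (K i x).
  move=> ji x; subst j; rewrite /K [LHS]/= [in RHS]/= linearB.
  have e := cmapP g (i := i) (i + 1) (x, 0).
  have sf := contracts_atE (f := cm_comp g (cone_in f)) (h := s) (i := i)
    (k := i + 1 + 1) (f (i + 1) x) (sP (i + 1)) erefl erefl.
  have split_z : cdiff (cone f) i (i + 1) (x, 0)
      = (- cdiff X (i + 1) (i + 1 + 1) x, 0) + cone_in f (i + 1) (f (i + 1) x).
    by rewrite cone_diffE; congr pair; rewrite /= ?linear0 ?addr0 ?add0r.
  rewrite -[X in _ = X - _]e split_z linearD [X in _ = _ + X - _]sf.
  rewrite -[RHS]addrA; congr (_ + _); rewrite [RHS]addrAC subrr add0r.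
  by rewrite !linearN opprK cmapP.
exists (chain_mapI KP), (fun i j => s i j \o snd) => i [x y].
rewrite cone_diffE /= /K /= opprB addrCA -raddfB /=.
rewrite [in RHS]linearD [RHS]addrCA; congr (_ + _).
apply: etrans (sP i y); congr (g i _).
by apply: (congr2 pair); rewrite ?subrr ?subr0.
Qed.

(** A contraction of the inclusion of [Y] in the cone has components
    [Y i -> X i] and [Y i -> Y (i - 1)]: the former is a chain map, the latter
    a homotopy that makes it a right inverse of [f]. *)
Section RightInverse.
Variable s : forall i j, {linear Y i -> cone f j}.
Hypothesis sP : forall i, contracts_at (cone_in f) s i.

Let G j : {linear Y j -> X j} := transport X (j - 1 + 1) j \o (fst \o s j (j - 1)).

Fact cone_section_shift i j y : j = i + 1 -> G j y = transport X (i + 1) j (s j i y).1.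
Proof. by move=> ji; have -> : i = j - 1 by lia. Qed.

Fact cone_section_eq i y :
  cone_in f i y = cdiff (cone f) (i - 1) i (s i (i - 1) y) + s (i + 1) i (cdiff Y i (i + 1) y).
Proof. exact: (@sP i y). Qed.

Fact cone_section_proof i j : j = i + 1 ->
  forall y, G j (cdiff Y i j y) = cdiff X i j (G i y).
Proof.
move=> ji y; subst j; rewrite (cone_section_shift _ erefl) transport_id.
have /(congr1 fst)/eqP := cone_section_eq y.
rewrite /= eq_sym [X in X == _]addrC subr_eq0 => /eqP ->.
by rewrite /G /= -(transport_cdiff (j := i + 1)) ?subrK ?transport_id.
Qed.

Definition cone_section : chain_map Y X := chain_mapI cone_section_proof.

Lemma cone_sectionE i j y : j = i + 1 ->
  cone_section j y = transport X (i + 1) j (s j i y).1.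
Proof. exact: cone_section_shift. Qed.

Lemma cone_sectionK : homotopic (cm_comp f cone_section) (cm_id Y).
Proof.
apply: homotopic_sym; exists (fun i j => snd \o s i j) => i y.
have /(congr1 snd) := cone_section_eq y; rewrite (cone_diff_any (i := i - 1)); last lia.
rewrite /= => {1}->; rewrite -[transport Y _ _ _]transport_cmap.
by rewrite [LHS]addrAC [X in X + _ = _]addrAC subrr add0r.
Qed.
End RightInverse.

Lemma cone_in_null_section : null_homotopic (cone_in f) ->
  exists g : chain_map Y X, homotopic (cm_comp f g) (cm_id Y).
Proof. by move=> [s sP]; exists (cone_section sP); apply: cone_sectionK. Qed.

(** Among the four components of a contraction of the cone, one is a map
    [Y -> X], and those on the diagonal are homotopies showing that it is
    inverse to [f] on either side. *)
Lemma contractible_cone_hequiv : null_homotopic (cm_id (cone f)) -> hequiv f.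
Proof.
move=> [H HP].
pose s i j : {linear Y i -> cone f j} := H i j \o cone_in f i.
have sP i : contracts_at (cone_in f) s i.
  move=> y; apply: etrans (HP i (cone_in f i y)) _; congr (_ + _).
  by rewrite -(cmapP (cone_in f) (i + 1) y).
exists (cone_section sP); split; last exact: cone_sectionK.
pose k i j : {linear X i -> X j} := transport X (j - 1 + 1) j \o
  (fst \o (H (i - 1) (j - 1) \o pair_map (transport X i (i - 1 + 1)) \0)).
have kE i j i' j' x : i = i' + 1 -> j = j' + 1 ->
    k i j x = transport X (j' + 1) j (H i' j' (transport X i (i' + 1) x, 0)).1.
  move=> ii' jj'; have -> : i' = i - 1 by lia.
  by have -> : j' = j - 1 by lia.
suff kP i : contracts_at (cm_sub (cm_comp (cone_section sP) f) (cm_id X)) k i.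
  by exists k.
have [i0 ->] : exists i0, i = i0 + 1 by exists (i - 1); lia.
apply: (contracts_atI (i := i0) (k := i0 + 1 + 1)) => // x.
rewrite (kE _ _ i0 (i0 - 1)) ?subrK // (kE _ _ (i0 + 1) i0) // !transport_id.
rewrite [LHS](_ : _ = cone_section sP (i0 + 1) (f (i0 + 1) x) - x) //.
rewrite (cone_sectionE sP (i := i0)) // transport_id.
have /(congr1 fst) := HP i0 (x, 0).
have -> : cdiff (cone f) i0 (i0 + 1) (x, 0)
    = cone_in f (i0 + 1) (f (i0 + 1) x) - (cdiff X (i0 + 1) (i0 + 1 + 1) x, 0).
  by rewrite cone_diffE; congr pair; rewrite /= ?linear0 ?addr0 ?add0r ?subr0.
rewrite linearB -(transport_cdiff (i := i0 - 1 + 1) (j := i0 + 1)) ?subrK //.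
rewrite transport_id /= => {2}->.
by rewrite !opprD !opprK addrCA; congr (_ + _); rewrite addrA subrr add0r.
Qed.

End Cone.

(** ** Distinguished triangles *)

(** Exactness of the functor of maps to [W] on a triangle; the isomorphisms with
    a cone triangle reduce it to [cone_extend]. *)
Lemma triangle_extend X Y Z (u : chain_map X Y) (v : chain_map Y Z) w
    W (g : chain_map Y W) :
  triangle u v w -> null_homotopic (cm_comp g u) ->
  exists g' : chain_map Z W, homotopic (cm_comp g' v) g.
Proof.
move=> [X' [Y' [f [a [b [c [[a_eq b_eq c_eq] [bu cv _]]]]]]]] gu0.
have [a' [a'a aa']] := a_eq; have [b' [b'b bb']] := b_eq.
have [|g' g'P] := @cone_extend X' Y' f W (cm_comp g b').
  have fE : homotopic f (cm_comp b (cm_comp u a')).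
    apply: homotopic_trans (homotopic_sym (homotopic_1comp f aa')) _.
    apply: homotopic_trans (homotopic_compA _ _ _) _.
    apply: homotopic_trans (homotopic_compr a' (homotopic_sym bu)) _.
    exact: homotopic_sym (homotopic_compA _ _ _).
  apply: null_homotopic_eq (homotopic_compl _ fE) _.
  apply: null_homotopic_eq (null_homotopic_compr a' gu0).
  apply: (homotopic_trans (g := cm_comp g (cm_comp (cm_comp b' b) (cm_comp u a')))).
    exact: homotopic_pointwise.
  apply: homotopic_trans (homotopic_compl g (homotopic_comp1 _ b'b)) _.
  exact: homotopic_pointwise.
exists (cm_comp g' c).
apply: homotopic_trans (homotopic_sym (homotopic_compA _ _ _)) _.
apply: homotopic_trans (homotopic_compl g' cv) _.
apply: homotopic_trans (homotopic_1comp g b'b).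
by apply: homotopic_pointwise => i y; apply: g'P.
Qed.

(** When [v] vanishes, the identity of the third term factors through the
    shift of the first; if it then vanishes, [u] is an isomorphism. *)
Lemma triangle_hiso X Y Z (u : chain_map X Y) (v : chain_map Y Z) w :
  triangle u v w -> null_homotopic v ->
  (forall X' Z', hiso X X' -> hiso Z Z' ->
    forall k : chain_map (shift 1 X') Z', null_homotopic k) ->
  hiso X Y.
Proof.
move=> [X' [Y' [f [a [b [c [[a_eq b_eq c_eq] [bu cv _]]]]]]]] v0 null.
have in0 : null_homotopic (cone_in f).
  have [b' [b'b bb']] := b_eq.
  apply: null_homotopic_eq (homotopic_sym (homotopic_1comp _ bb')) _.
  apply: null_homotopic_eq (homotopic_compA _ _ _) _.
  apply: null_homotopic_compr.
  exact: null_homotopic_eq (homotopic_sym cv) (null_homotopic_compl c v0).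
have [|k kP] := @cone_factor X' Y' f _ (cm_id (cone f)).
  by apply: null_homotopic_eq in0; apply: homotopic_pointwise.
have isoX : hiso X X' by exists a.
have isoZ : hiso Z (cone f) by exists c.
have f_eq : hequiv f.
  apply: contractible_cone_hequiv; apply: null_homotopic_eq kP _.
  exact/null_homotopic_compr/null.
apply: hiso_trans isoX _; apply: (hiso_trans (Y := Y')); first by exists f.
by apply: hiso_sym; exists b.
Qed.

Lemma triangle_cone X Y Z (f : chain_map X Y) (b : chain_map Z Y) (b' : chain_map Y Z) :
  homotopic (cm_comp b' b) (cm_id Z) -> homotopic (cm_comp b b') (cm_id Y) ->
  triangle (cm_comp b' f) (cm_comp (cone_in f) b) (cone_out f).
Proof.
move=> b'b bb'.
have id_eq W : hequiv (cm_id W).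
  by exists (cm_id W); split; apply: homotopic_pointwise.
exists X, Y, f, (cm_id X), b, (cm_id (cone f)); split; first by split=> //; exists b'.
split; try exact: homotopic_pointwise.
apply: homotopic_trans (homotopic_compA _ _ _) _.
by apply: homotopic_trans (homotopic_comp1 f bb') _; apply: homotopic_pointwise.
Qed.

End Comparison.

(** * Comparison of projective resolutions *)

Section Resolution.
Variables (S : pzRingType) (M : lmodType S).
Implicit Types P Q : nat -> lmodType S.

(** A resolution together with the module it resolves, as a single sequence to
    which [descend] applies. *)
Definition augmented P (k : nat) : lmodType S := if k is k'.+1 then P k' else M.

Definition augmented_diff P (d : forall k, {linear P k.+1 -> P k}) (e : {linear P 0%N -> M}) k :
  {linear augmented P k.+1 -> augmented P k} := if k is k'.+1 then d k' else e.

Lemma resolution_lift P (d : forall k, {linear P k.+1 -> P k}) (e : {linear P 0%N -> M})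
    Q (d' : forall k, {linear Q k.+1 -> Q k}) (e' : {linear Q 0%N -> M}) :
  (forall k, projective (P k)) -> (forall x, e (d 0%N x) = 0) ->
  (forall k x, d k (d k.+1 x) = 0) ->
  (forall y, exists x, e' x = y) -> (forall x, e' x = 0 -> exists y, d' 0%N y = x) ->
  (forall k x, d' k x = 0 -> exists y, d' k.+1 y = x) ->
  exists f : forall k, {linear P k -> Q k},
    (forall x, e' (f 0%N x) = e x) /\ forall k x, d' k (f k.+1 x) = f k (d k x).
Proof.
move=> projP ed dd e'_surj e'_ker d'_ker.
have [||||f [f0 fP]] := @descend S (augmented P) (augmented Q)
  (fun k => \- augmented_diff d e k) (augmented_diff d' e') (fun k => \0) idfun.
- exact: projP.
- by case=> [|k] x /=; rewrite linearN opprK ?ed ?dd.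
- by move=> k x /=; rewrite linear0.
- by move=> x /=; rewrite sub0r opprK; apply: e'_surj.
have {}fP k x : augmented_diff d' e' k (f k.+1 x) = f k (augmented_diff d e k x).
  rewrite fP /= ?linearN ?sub0r ?opprK // => -[|j] _ y; first exact: e'_ker.
  exact: d'_ker.
exists (fun k => f k.+1); split=> [x|k x]; last exact: (fP k.+1 x).
by have := fP 0%N x; rewrite f0.
Qed.

(** The two comparison maps between [P] and a projective resolution of length
    [n] compose to zero above [n], yet their composite is homotopic to the
    identity: [P] splits in those degrees. *)
Lemma resolution_split P (d : forall k, {linear P k.+1 -> P k}) (e : {linear P 0%N -> M}) n :
  (forall k, projective (P k)) -> (forall y, exists x, e x = y) ->
  (forall x, e x = 0 <-> exists y, d 0%N y = x) ->
  (forall k x, d k x = 0 <-> exists y, d k.+1 y = x) ->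
  projdim_le M n ->
  exists s : forall k, {linear P k -> P k.+1},
    forall k, (n <= k)%N -> forall x, x = d k.+1 (s k.+1 x) + s k (d k x).
Proof.
move=> projP e_surj e_ker d_ker [Q [d' [e' [projQ Q0 e'_surj e'_ker d'_ker]]]].
have [f [f0 fP]] : exists f : forall k, {linear P k -> Q k},
    (forall x, e' (f 0%N x) = e x) /\ forall k x, d' k (f k.+1 x) = f k (d k x).
  apply: resolution_lift => // [x|k x|x|k x]; first by apply/e_ker; exists x.
  - by apply/d_ker; exists x.
  - by move/e'_ker.
  - by move/d'_ker.
have [g [g0 gP]] : exists g : forall k, {linear Q k -> P k},
    (forall x, e (g 0%N x) = e' x) /\ forall k x, d k (g k.+1 x) = g k (d' k x).
  apply: resolution_lift => // [x|k x|x|k x]; first by apply/e'_ker; exists x.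
  - by apply/d'_ker; exists x.
  - by move/e_ker.
  - by move/d_ker.
have [||||s [s0 sP]] := @descend S (augmented P) P (augmented_diff d e) d
  (fun k => idfun \- (g k \o f k)) (\0 : {linear M -> P 0%N}).
- exact: projP.
- by case=> [|k] x /=; [apply/e_ker | apply/d_ker]; exists x.
- by move=> k x /=; rewrite linearB gP fP.
- by move=> x; rewrite /= subr0; apply/e_ker; rewrite linearB g0 f0 subrr.
exists (fun k => s k.+1) => k le_nk x.
have := sP k.+1 (fun j _ y => (d_ker j y).1) x.
by rewrite /= [f k.+1 x]Q0 // linear0 subr0 => ->; rewrite subrK.
Qed.
End Resolution.

(** * The dual of a finitely generated projective module *)

Section Dual.
Variable R : pzRingType.
Implicit Types P Q : lmodType R.

Definition functional P (phi : P -> R^c^o) : Prop :=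
  forall (a : R) x y, phi (a *: x + y) = a * (phi x : R) + (phi y : R) :> R.

Fact functional_closed0 P : functional (0 : P -> R^c^o).
Proof.
move=> a x y; have E z : (0 : P -> R^c^o) z = 0 :> R by [].
by rewrite !E mulr0 add0r.
Qed.

Fact functional_closedP P (r : R^c) (phi psi : P -> R^c^o) :
  functional phi -> functional psi -> functional (r *: phi + psi).
Proof.
move=> phiP psiP a x y.
have E z : (r *: phi + psi) z = (phi z : R) * (r : R) + (psi z : R) by [].
by rewrite !E phiP psiP mulrDl mulrDr !mulrA addrACA.
Qed.

(** Left linear forms make up a right module: the scalars of [R^c] act by right
    multiplication on the values. *)
Definition dual P : lmodType R^c :=
  sub_of (Submodule (@functional_closed0 P) (@functional_closedP P)).

Definition form P (phi : dual P) : P -> R := val phi.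

Fact form_linear P (phi : dual P) : linear (form phi : P -> R^o).
Proof. exact: (subP phi). Qed.

Definition dual_linear P (phi : dual P) : {linear P -> R^o} := lin (form_linear phi).

Fact mkdual_proof P (f : {linear P -> R^o}) : functional (f : P -> R^c^o).
Proof. by move=> a x y; apply: linearP. Qed.

Definition mkdual P (f : {linear P -> R^o}) : dual P :=
  mksub (S := Submodule (@functional_closed0 P) (@functional_closedP P)) (mkdual_proof f).

Lemma dual_eq P (phi psi : dual P) : (forall x, form phi x = form psi x) -> phi = psi.
Proof. by move=> e; apply/val_inj/funext. Qed.

Lemma formP P (r : R^c) (phi psi : dual P) x :
  form (r *: phi + psi) x = form phi x * (r : R) + form psi x.
Proof. by []. Qed.

Lemma formD P (phi psi : dual P) x :
  form (phi + psi) x = form phi x + form psi x.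
Proof. by []. Qed.

Lemma form0 P x : form (0 : dual P) x = 0.
Proof. by []. Qed.

Lemma form_at0 P (phi : dual P) : form phi 0 = 0.
Proof. exact: (linear0 (dual_linear phi)). Qed.

Lemma form_sum P I (r : seq I) (F : I -> dual P) x :
  form (\sum_(i <- r) F i) x = \sum_(i <- r) form (F i) x.
Proof.
elim: r => [|i r IHr]; first by rewrite !big_nil.
by rewrite !big_cons -IHr -[F i in LHS]scale1r formP mulr1.
Qed.

Section DualMap.
Variables (P Q : lmodType R) (f : {linear P -> Q}).
Fact dual_map_linear : linear (fun phi : dual Q => mkdual (dual_linear phi \o f)).
Proof. by move=> r phi psi; apply: dual_eq => x. Qed.
Definition dual_map : {linear dual Q -> dual P} := lin dual_map_linear.
Lemma form_dual_map phi x : form (dual_map phi) x = form phi (f x).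
Proof. by []. Qed.
End DualMap.

Section Basis.
Variables (P : lmodType R) (n : nat).
Variables (i : {linear P -> 'rV[R]_n}) (p : {linear 'rV[R]_n -> P}).
Hypothesis pK : forall x, p (i x) = x.

Let c j := p (delta_mx 0 j).

Fact coord_form_linear j : linear (fun x => i x 0 j : R^o).
Proof. by move=> a x y; rewrite linearP !mxE. Qed.
Definition coord_form j : dual P := mkdual (lin (coord_form_linear j)).

Lemma basis_expand x : x = \sum_j form (coord_form j) x *: c j.
Proof. by rewrite -{1}(pK x) (linear_row_sum p). Qed.

Lemma dual_expand (phi : dual P) : phi = \sum_j (form phi (c j) : R^c) *: coord_form j.
Proof.
apply: dual_eq => x; rewrite form_sum {1}(basis_expand x).
rewrite -[LHS]/(dual_linear phi _) linear_sum; apply: eq_bigr => j _.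
by rewrite linearZ -[in RHS](addr0 (_ *: _)) formP form0 addr0.
Qed.

(** On the dual basis, [s] is determined by its values [s (coord_form j)], which
    are the coordinates of the element representing it. *)
Lemma reflexive_split (s : {linear dual P -> R^c^o}) :
  exists y, forall psi, s psi = form psi y :> R.
Proof.
exists (\sum_j (s (coord_form j) : R) *: c j) => psi.
rewrite {1}(dual_expand psi) linear_sum -[RHS]/(dual_linear psi _) linear_sum.
by apply: eq_bigr => j _; rewrite !linearZ.
Qed.

Lemma separated_split x y : (forall phi : dual P, form phi x = form phi y) -> x = y.
Proof.
by move=> e; rewrite (basis_expand x) (basis_expand y); apply: eq_bigr => j _; rewrite e.
Qed.

Fact dual_to_row_linear : linear (fun phi : dual P => \row_j (form phi (c j) : R^c)).
Proof. by move=> r phi psi; apply/rowP => j; rewrite !mxE. Qed.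

Fact dual_of_row_linear :
  linear (fun y : 'rV[R^c]_n => \sum_j y 0 j *: coord_form j).
Proof.
move=> r y z; rewrite scaler_sumr -big_split; apply: eq_bigr => j _.
by rewrite !mxE scalerDl scalerA.
Qed.

Lemma fg_proj_dual_split : fg_proj (dual P).
Proof.
apply: (fg_proj_retract (B := 'rV[R^c]_n) (i := lin dual_to_row_linear)
          (p := lin dual_of_row_linear)); last exact: fg_proj_row.
by move=> phi; rewrite [RHS]dual_expand /=; apply: eq_bigr => j _; rewrite mxE.
Qed.
End Basis.

Lemma fg_proj_dual P : fg_proj P -> fg_proj (dual P).
Proof. by move=> /fg_proj_split[n [i [p pK]]]; apply: fg_proj_dual_split pK. Qed.

Lemma fg_proj_reflexive P (s : {linear dual P -> R^c^o}) : fg_proj P ->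
  exists y, forall psi, s psi = form psi y :> R.
Proof. by move=> /fg_proj_split[n [i [p pK]]]; apply: reflexive_split pK _. Qed.

Lemma fg_proj_separated P x y : fg_proj P ->
  (forall phi : dual P, form phi x = form phi y) -> x = y.
Proof. by move=> /fg_proj_split[n [i [p pK]]]; apply: (separated_split pK). Qed.

(** The dual complex is exact in degrees [> m], so it resolves the image of its
    differential at [m]; by the bound on the dimension it splits above degree
    [m + n + 1].  The splitting maps need not be given as duals of maps, but
    evaluation at a cycle [x] turns them into linear forms on a dual module,
    which by reflexivity are evaluations at some [y]; then [x] is the boundary
    of [y]. *)
Lemma findim_acyclic n (X : cochain R) (m : int) :
  findim_le R^c n -> bounded_above X -> (forall i, fg_proj (X i)) ->
  (forall i j k, m < j -> j = i + 1 -> k = j + 1 -> forall phi : dual (X j),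
     dual_map (cdiff X i j) phi = 0 -> exists psi, dual_map (cdiff X j k) psi = phi) ->
  forall i, m + n%:Z + 1 < i -> acyclic_at X i.
Proof.
move=> findim [t X0] projX exactD.
pose I (k : nat) := m + 1 + k%:Z.
pose D (k : nat) := dual (X (I k)).
pose d (k : nat) : {linear D k.+1 -> D k} := dual_map (cdiff X (I k) (I k.+1)).
pose d0 : {linear D 0%N -> dual (X m)} := dual_map (cdiff X m (I 0%N)).
pose e := @corestrict _ _ _ (image_sub d0) d0 (fun x => ex_intro _ x erefl).
have e_surj y : exists x, e x = y.
  by have [x xy] := subP y; exists x; apply: val_inj.
have projD k : fg_proj (D k) by apply: fg_proj_dual.
have e_ker x : e x = 0 <-> exists y, d 0%N y = x.
  split=> [/(congr1 val) /= ex | [y <-]]; first by apply: (exactD m); rewrite /I; try lia.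
  by apply: val_inj; apply: dual_eq => z /=; rewrite !form_dual_map cdiffK form_at0.
have d_ker k x : d k x = 0 <-> exists y, d k.+1 y = x.
  split=> [dx | [y <-]]; first by apply: (exactD (I k)); rewrite /I; try lia.
  by apply: dual_eq => z /=; rewrite !form_dual_map cdiffK form_at0.
have pdM : projdim_le (sub_of (image_sub d0)) n.
  apply: findim; exists `|(t - m)%R|%N, D, d, e; split=> // k lt_k x.
  by apply: dual_eq => z; rewrite form0 (X0 _ _ z) ?form_at0 // /I; lia.
have [s sP] := resolution_split (fun k => (projD k).2) e_surj e_ker d_ker pdM.
move=> i lt_i; have [k le_nk ik] : exists2 k : nat, (n <= k)%N & i = I k.+1.
  by exists (`|(i - m)%R|%N - 2)%N; rewrite /I; lia.
subst i; apply: (acyclicI (i := I k) (k := I k.+2)); rewrite /I; try lia.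
rewrite -/(I _) -/(I _) => x dx.
have evalP : linear (fun psi : D k => form (s k psi) x : R^c^o).
  by move=> r phi psi; rewrite linearP.
(* Through [s], the cycle [x] becomes a linear form on the dual of [X (I k)]. *)
have [y yP] := fg_proj_reflexive (lin evalP) (projX (I k)).
exists y; apply: (fg_proj_separated (projX _)) => phi.
rewrite -[LHS](form_dual_map (cdiff X (I k) (I k.+1)) phi y) -yP.
rewrite [in RHS](sP k le_nk phi) formD [form (d k.+1 _) x]form_dual_map dx.
by rewrite form_at0 add0r.
Qed.
End Dual.

(** * Stalk complexes of the ring *)

Section Stalk.
Variable R : pzRingType.
Implicit Types (X Y : cochain R) (i j k c n : int).

Definition constant_complex : cochain R :=
  @Cochain R (fun _ => R^o) (fun _ _ => \0) (fun _ _ _ _ => erefl) (fun _ _ _ _ => erefl).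

Let S c i := cut (i == c) (\0 : {linear R^o -> R^o}).

Fact stalk_closed c i x : S c i x -> S c (i + 1) (cdiff constant_complex i (i + 1) x).
Proof. by move=> _; apply: sub_closed0. Qed.

(** Cut out of the constant complex, so that shifting a stalk needs no
    transport. *)
Definition stalk c := subcomplex (X := constant_complex) (@stalk_closed c).

Lemma stalk_eq0 c i (x : stalk c i) : i != c -> x = 0.
Proof. exact: cut_eq0. Qed.

Lemma stalk_diff0 c i j (x : stalk c i) : cdiff (stalk c) i j x = 0.
Proof. exact: val_inj. Qed.

Lemma fg_proj_ring : fg_proj (R^o : lmodType R).
Proof.
have const_linear : linear (fun x : R^o => const_mx x : 'rV[R]_1).
  by move=> a x y; apply/rowP => j; rewrite !mxE.
apply: (fg_proj_retract (i := lin const_linear) (p := row_map (fun=> 1 : R^o))).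
  by move=> x; rewrite /= big_ord1 mxE; apply: mulr1.
exact: fg_proj_row.
Qed.

Lemma stalk_fg_proj c i : fg_proj (stalk c i).
Proof. by apply: fg_proj_cut => // _; apply: fg_proj_ring. Qed.

Lemma Kb_proj_stalk c : Kb_proj (stalk c).
Proof.
exists (stalk c); split; last exact: hiso_refl.
- by exists c, c => i lt_i x; apply: stalk_eq0; lia.
- by move=> i; apply: stalk_fg_proj.
Qed.

Lemma shift_stalk c n : hiso (shift n (stalk c)) (stalk (c - n)).
Proof.
have FP i (x : shift n (stalk c) i) :
    S (c - n) i ((val : {linear stalk c (i + n) -> R^o}) x).
  have e : (i == c - n) = (i + n == c) by lia.
  by have := subP x; rewrite /S /= e.
have GP i (x : stalk (c - n) i) : S c (i + n) ((val : {linear stalk (c - n) i -> R^o}) x).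
  have e : (i == c - n) = (i + n == c) by lia.
  by have := subP x; rewrite /S /= -e.
have FdP i j : j = i + 1 -> forall x,
    corestrict (@FP j) (cdiff (shift n (stalk c)) i j x)
    = cdiff (stalk (c - n)) i j (corestrict (@FP i) x).
  by move=> _ x; apply: val_inj; rewrite /= sign_linE; case: odd; rewrite //= oppr0.
have GdP i j : j = i + 1 -> forall x,
    corestrict (@GP j) (cdiff (stalk (c - n)) i j x)
    = cdiff (shift n (stalk c)) i j (corestrict (@GP i) x).
  by move=> _ x; apply: val_inj; rewrite /= sign_linE; case: odd; rewrite //= oppr0.
by apply: (hiso_strict (f := @chain_mapI _ (shift n (stalk c)) (stalk (c - n)) _ FdP)
     (g := @chain_mapI _ (stalk (c - n)) (shift n (stalk c)) _ GdP)) => i x; apply: val_inj.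
Qed.

(** A cycle of degree [c] is a chain map from the stalk; a homotopy of this map
    to zero exhibits the cycle as a boundary. *)
Lemma acyclic_of_stalk Y c :
  (forall f : chain_map (stalk c) Y, null_homotopic f) -> acyclic_at Y c.
Proof.
move=> null y dy.
have scale_linear : linear (fun a : R^o => (a : R) *: y).
  by move=> a b b'; rewrite scalerDl -scalerA.
pose F i : {linear stalk c i -> Y i} :=
  transport Y c i \o (lin scale_linear \o (val : {linear stalk c i -> R^o})).
have FP i j : j = i + 1 -> forall x, F j (cdiff (stalk c) i j x) = cdiff Y i j (F i x).
  move=> ji x; subst j; rewrite stalk_diff0 linear0.
  have [ic|/eqP ne_ic] := pselect (i = c); last first.
    by rewrite (stalk_eq0 x ne_ic) !linear0.
  by subst i; rewrite /F /= transport_id linearZ /= dy scaler0.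
have one_c : S c c (1 : R^o) by rewrite /S /= eqxx.
have [h hP] := null (chain_mapI FP); exists (h c (c - 1) (mksub one_c)).
have := hP c (mksub one_c).
by rewrite stalk_diff0 linear0 addr0 /= /F /= transport_id scale1r.
Qed.

(** A cocycle of the dual complex is a chain map to the stalk, and a homotopy of
    this map to zero exhibits it as a coboundary. *)
Lemma dual_exact_of_stalk X c i k : i + 1 = c -> c + 1 = k ->
  (forall f : chain_map X (stalk c), null_homotopic f) ->
  forall phi : dual (X c), dual_map (cdiff X i c) phi = 0 ->
  exists psi, dual_map (cdiff X c k) psi = phi.
Proof.
move=> ic <- null phi dphi.
pose F i : {linear X i -> R^o} := dual_linear phi \o transport X i c.
have FS j x : S c j (F j x).
  by rewrite /S /=; case: eqP => // /eqP ne_jc; rewrite /F /= transport_ne ?form_at0.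
have FP j k' : k' = j + 1 -> forall x,
    corestrict (@FS k') (cdiff X j k' x) = cdiff (stalk c) j k' (corestrict (@FS j) x).
  move=> kj x; apply: val_inj; rewrite /= /F /=.
  have [e|/eqP ne_kc] := pselect (k' = c); last first.
    by rewrite transport_ne ?form_at0.
  have ji : j = i by lia.
  clear kj; subst k' j; rewrite transport_id.
  by rewrite -[LHS](form_dual_map (cdiff X i c)) dphi.
have [h hP] := null (@chain_mapI _ X (stalk c) _ FP).
exists (mkdual ((val : {linear stalk c c -> R^o}) \o h (c + 1) c)).
apply: dual_eq => x; rewrite form_dual_map.
have /(congr1 val) := hP c x; rewrite stalk_diff0 add0r /= /F /= transport_id.
by move=> ->.
Qed.
End Stalk.

(** * Perfect and pseudo-coherent complexes *)

Section Perfect.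
Variable R : pzRingType.
Implicit Types (X Y Z : cochain R) (T L G : cochain R -> Prop).

Lemma Kb_proj_iso : iso_closed (@Kb_proj R).
Proof.
move=> X Y [P [bP projP XP]] XY; exists P; split=> //.
exact: hiso_trans (hiso_sym XY) XP.
Qed.

Lemma Kb_proj_shift n X : Kb_proj X -> Kb_proj (shift n X).
Proof.
move=> [P [[a [b P0]] projP XP]]; exists (shift n P); split.
- by exists (a - n), (b - n) => i lt_i x; apply: P0; lia.
- by move=> i; apply: projP.
- exact: shift_hiso.
Qed.

Lemma Kb_proj_unshift n X : Kb_proj (shift n X) -> Kb_proj X.
Proof.
move=> /(Kb_proj_shift (- n)) KX; apply: Kb_proj_iso KX _.
by apply: hiso_trans (shift_shift _ _ _) _; rewrite addNr; apply: shift0.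
Qed.

Lemma Kb_proj_sub_Kmb X : Kb_proj X -> Kmb_proj X.
Proof.
move=> [P [[a [b P0]] projP XP]]; exists P; split=> //.
  by exists b => i lt_i x; apply: P0; lia.
by exists a, b => i lt_i; apply: acyclic_zero => x; apply: P0.
Qed.

Lemma Kmb_proj_null X Y (f : chain_map X Y) (a : int) : Kmb_proj X ->
  (forall i, a < i -> acyclic_at X i) -> (forall i, i <= a -> acyclic_at Y i) ->
  null_homotopic f.
Proof.
move=> [P [bP _ projP XP]] acX acY; move: f.
apply: (null_homotopic_hiso XP (hiso_refl Y)) => f.
apply: (@null_homotopic_amplitude _ _ _ f a) => // i; first by have [] := projP i.
move=> lt_ai.
exact: acyclic_hiso (hiso_sym XP) (acX i lt_ai).
Qed.

(** The contraction [h] of the identity below [e] splits [X e] as the image of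
    the differential plus the kernel of [d h]; replacing [X e] by the latter
    and dropping everything below gives a bounded deformation retract. *)
Lemma Kb_proj_of_contraction X (h : forall i j, {linear X i -> X j}) e :
  bounded_above X -> (forall i, fg_proj (X i)) ->
  (forall i, i <= e -> contracts_at (cm_id X) h i) -> Kb_proj X.
Proof.
move=> [t X0] projX hP.
have [pi [pi_ne pi_e]] : exists pi : forall i, {linear X i -> X e},
    (forall i x, i != e -> pi i x = 0) /\
    (forall x, pi e x = cdiff X (e - 1) e (h e (e - 1) x)).
  exists (fun i => cdiff X (e - 1) e \o (h e (e - 1) \o transport X i e)).
  by split=> [i x ne_ie | x] /=; rewrite ?transport_id // transport_ne // !linear0.
pose S i := cut (e <= i) (pi i).
have S_closed i x : S i x -> S (i + 1) (cdiff X i (i + 1) x).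
  rewrite /S /=; case: ifP => [le_ei _|_ ->]; last by rewrite linear0; case: ifP; rewrite ?linear0.
  have le_ei1 : e <= i + 1 by lia.
  by rewrite le_ei1 pi_ne //; lia.
pose Y := subcomplex S_closed.
have pi_im x : pi e (cdiff X (e - 1) e x) = cdiff X (e - 1) e x.
  rewrite pi_e; have le1 : e - 1 <= e by lia.
  have /= {2}-> := contracts_atE (f := cm_id X) (h := h) (i := e - 1 - 1) (k := e) x
    (hP (e - 1) le1) ltac:(lia) ltac:(lia).
  by rewrite linearD cdiffK add0r.
pose rho i : {linear X i -> X i} :=
  if e <= i then (idfun \- (transport X e i \o pi i) : {linear X i -> X i}) else \0.
have rho_gt i x : e < i -> rho i x = x.
  move=> lt_ei; have ne_ie : i != e by lia.
  by rewrite /rho ltW //= pi_ne // linear0 subr0.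
have rho_lt i x : i < e -> rho i x = 0 by move=> lt_ie; rewrite /rho leNgt lt_ie.
have rho_e x : rho e x = x - pi e x by rewrite /rho lexx /= transport_id.
have rhoS i x : S i (rho i x).
  rewrite /S /in_sub /cut.
  have [lt_ei|lt_ie|ei] := ltgtP e i; first by rewrite pi_ne //; lia.
    exact: rho_lt.
  by subst i; rewrite rho_e linearB pi_e pi_im subrr.
have rhoP i j : j = i + 1 -> forall x,
    corestrict (@rhoS j) (cdiff X i j x) = cdiff Y i j (corestrict (@rhoS i) x).
  move=> ji x; apply: val_inj.
  change (rho j (cdiff X i j x) = cdiff X i j (rho i x)).
  have [lt_ei|lt_ie|ei] := ltgtP e i; first by rewrite !rho_gt //; lia.
    rewrite (rho_lt i) // linear0.
    have [lt_je|le_ej] := ltP j e; first exact: rho_lt.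
    have je : j = e by lia.
    have ie : i = e - 1 by lia.
    by clear ji; subst j i; rewrite rho_e pi_im subrr.
  by subst i; rewrite rho_e rho_gt ?linearB /= ?pi_e ?cdiffK ?subr0 //; lia.
pose r := @chain_mapI _ X Y _ rhoP.
pose u := subcomplex_incl S_closed.
have ruE i (y : Y i) : r i (u i y) = y.
  apply: val_inj; change (rho i (val y) = val y).
  have [lt_ei|lt_ie|ei] := ltgtP e i; first exact: rho_gt.
    have -> : y = 0 by apply: cut_eq0; rewrite -ltNge.
    by rewrite linear0.
  subst i; rewrite rho_e; move: (val y) (subP y) => x.
  by rewrite /S /= lexx => ->; rewrite subr0.
exists Y; split.
- by exists e, t => i lt_i y; apply: val_inj; have [lt_ie|lt_ti] := orP lt_i;
    [rewrite (cut_eq0 y) // -ltNge | rewrite [LHS]X0 // linear0].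
- by move=> i; apply: (fg_proj_retract (ruE i)).
exists r, u; split; last by apply: homotopic_pointwise => i y; apply: ruE.
pose k i j : {linear X i -> X j} :=
  if i <= e then (\- h i j : {linear X i -> X j}) else \0.
exists k => i x; change (rho i x - x = cdiff X (i - 1) i (k i (i - 1) x)
                                + k (i + 1) i (cdiff X i (i + 1) x)).
rewrite /k; have [lt_ei|lt_ie|ei] := ltgtP i e.
- have le_i1e : i + 1 <= e by lia.
  rewrite le_i1e rho_lt // sub0r [in LHS](hP i (ltW lt_ei) x : x = _).
  by rewrite opprD linearN.
- have lt_ei1 : ~~ (i + 1 <= e) by lia.
  by rewrite (negPf lt_ei1) rho_gt // subrr linear0 addr0.
have lt_ei1 : ~~ (i + 1 <= e) by lia.
rewrite (negPf lt_ei1); subst i; rewrite rho_e addr0 addrAC subrr add0r pi_e.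
by rewrite linearN.
Qed.

End Perfect.

(** * Bounded t-structures *)

Section TStructure.
Variable R : pzRingType.
Implicit Types (X Y Z U V : cochain R) (T L G : cochain R -> Prop) (n m a b i : int).

Lemma shiftNK n X : hiso (shift n (shift (- n) X)) X.
Proof. by apply: hiso_trans (shift_shift _ _ _) _; rewrite addrN; apply: shift0. Qed.

Lemma shiftKN n X : hiso (shift (- n) (shift n X)) X.
Proof. by apply: hiso_trans (shift_shift _ _ _) _; rewrite addNr; apply: shift0. Qed.

Lemma shift_split a b X : hiso (shift (b - a) (shift a X)) (shift b X).
Proof. by have := shift_shift (b - a) a X; rewrite subrK. Qed.

Lemma degE L n X : iso_closed L -> deg L n X <-> L (shift n X).
Proof.
move=> isoL; split=> [[Y LY XY] | LX].
  apply: isoL LY _; apply/hiso_sym.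
  exact: hiso_trans (shift_hiso n XY) (shiftNK n Y).
by exists (shift n X) => //; apply/hiso_sym/shiftKN.
Qed.

Section Aisle.
Variables T L G : cochain R -> Prop.
Hypothesis tLG : t_structure T L G.

Let isoL : iso_closed L := ts_isoL tLG.
Let isoG : iso_closed G := ts_isoG tLG.

Lemma aisle_shift a b X : a <= b -> L (shift a X) -> L (shift b X).
Proof.
move=> le_ab LX; apply: isoL (shift_split a b X).
move: (shift a X) LX => Y LY.
have [k ->] : exists k : nat, b - a = k%:Z by exists `|(b - a)%R|%N; lia.
elim: k => [|k IHk]; first exact: isoL LY (hiso_sym (shift0 Y)).
apply: (ts_monoL tLG); apply/degE => //.
apply: isoL IHk _; apply/hiso_sym; apply: hiso_trans (shift_shift _ _ _) _.
by rewrite (_ : - 1 + k.+1%:Z = k%:Z); [apply: hiso_refl | lia].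
Qed.

Lemma orthogonal a b X Y (f : chain_map X Y) : a < b ->
  L (shift a X) -> G (shift b Y) -> null_homotopic f.
Proof.
move=> lt_ab LX GY; apply: (shift_map_null_inv (n := b)).
apply: (ts_hom0 tLG) => //; apply/degE => //.
apply: isoL (hiso_sym (shift_shift _ _ _)).
by apply: aisle_shift LX; lia.
Qed.

(** The truncation triangle of [Z] degenerates: its second map vanishes, which
    forces its third term to vanish. *)
Lemma aisle_of_orthogonal Z : T Z ->
  (forall V (f : chain_map Z V), G V -> null_homotopic f) -> L Z.
Proof.
move=> TZ null; have [U [V [u [v [w [LU GV tri]]]]]] := ts_trunc tLG TZ.
apply: isoL (ts_monoL tLG LU) _.
apply: triangle_hiso tri (null V v GV) _ => U' V' UU' VV' k.
(* [U] is in degrees [<= -1] for the t-structure, so [U[1]] is in degrees [<= -2]. *)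
apply: (@orthogonal (- 2) 0) => //; last first.
  exact: isoG GV (hiso_trans VV' (hiso_sym (shift0 V'))).
have /degE-/(_ isoL) LU1 := LU.
apply: isoL LU1 _; apply: hiso_trans (shift_hiso _ UU') _.
exact: hiso_sym (shift_shift (- 2) 1 U').
Qed.

Section Ring.
Hypothesis stalkT : T (stalk R 0).
Hypothesis subT : subcat T (@Kmb_proj R).
Hypothesis bounded_ts : bounded_t_structure T L G.

Lemma coaisle_acyclic : exists m, forall V, G V -> forall i, i < m -> acyclic_at V i.
Proof.
have [_ TL _] := bounded_ts; have /TL[m] := stalkT.
move=> /(degE _ _ isoL) Lm; exists (- m%:Z) => V GV i lt_im.
apply: acyclic_of_stalk => f; apply: (@orthogonal (i + m%:Z) 0) => //; try lia.
  apply: isoL Lm _; apply: hiso_trans (shift_stalk R 0 m) _; apply/hiso_sym.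
  apply: hiso_trans (shift_stalk R i (i + m%:Z)) _.
  by rewrite (_ : i - (i + m%:Z) = 0 - m%:Z); [apply: hiso_refl | lia].
exact: isoG GV (hiso_sym (shift0 V)).
Qed.

Lemma aisle_of_acyclic : exists c, forall Z, T Z ->
  (forall i, c < i -> acyclic_at Z i) -> L Z.
Proof.
have [m mP] := coaisle_acyclic; exists (m - 1) => Z TZ acZ.
apply: aisle_of_orthogonal => // V f GV.
apply: Kmb_proj_null (subT TZ) acZ _ => i le_im; apply: mP => //; lia.
Qed.

(** By orthogonality, [U] has no maps to the stalks of [R] in degrees above that
    in which [R] belongs to the coaisle. *)
Lemma aisle_acyclic : findim_finite R^c ->
  exists c, forall U, L U -> forall i, c < i -> acyclic_at U i.
Proof.
move=> [n findim]; have [_ _ TG] := bounded_ts; have /TG[m] := stalkT.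
move=> /(degE _ _ isoG) Gm; exists (m%:Z + n%:Z + 1) => U LU i lt_i.
have [P [bP _ projP UP]] := subT (ts_subL tLG LU).
apply: (acyclic_hiso UP); apply: (findim_acyclic findim bP projP _ lt_i).
move=> i0 j k lt_mj ji kj phi; apply: dual_exact_of_stalk => // f.
apply: (@orthogonal 0 (j - m%:Z)) => //; try lia.
  by apply: isoL LU _; apply: hiso_trans UP (hiso_sym (shift0 P)).
apply: isoG Gm _; apply: hiso_trans (shift_stalk R 0 (- m%:Z)) _; apply/hiso_sym.
apply: hiso_trans (shift_stalk R j (j - m%:Z)) _.
by rewrite (_ : j - (j - m%:Z) = 0 - - m%:Z); [apply: hiso_refl | lia].
Qed.
End Ring.
End Aisle.

Lemma bounded_t_structures_equivalent T L1 G1 L2 G2 : findim_finite R^c ->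
  iso_closed T -> (forall n X, T X -> T (shift n X)) ->
  subcat (@Kb_proj R) T -> subcat T (@Kmb_proj R) ->
  bounded_t_structure T L1 G1 -> bounded_t_structure T L2 G2 -> t_equivalent L1 L2.
Proof.
move=> findim isoT shiftT KbT TKmb bts1 bts2.
have [ts1 _ _] := bts1; have [ts2 _ _] := bts2.
have stalkT : T (stalk R 0) by apply/KbT/Kb_proj_stalk.
have [N1 acL1] := aisle_acyclic ts1 stalkT TKmb bts1 findim.
have [N2 acL2] := aisle_acyclic ts2 stalkT TKmb bts2 findim.
have [c1 L1I] := aisle_of_acyclic ts1 stalkT TKmb bts1.
have [c2 L2I] := aisle_of_acyclic ts2 stalkT TKmb bts2.
exists (`|(N1 - c2)%R|%N + `|(N2 - c1)%R|%N)%N; set n : nat := (_ + _)%N.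
have [le1 le2] : N1 - n%:Z <= c2 /\ N2 - n%:Z <= c1 by rewrite /n; lia.
split=> X.
  move=> /(degE _ _ (ts_isoL ts1)) LX; apply: L2I.
    by apply: isoT (shiftNK n%:Z X); apply/shiftT/(ts_subL ts1).
  move=> i lt_i; have /acyclic_shift := acL1 _ LX (i + n%:Z) ltac:(lia).
  by rewrite addrK.
move=> LX; apply/(degE _ _ (ts_isoL ts1)); apply: L1I.
  exact/shiftT/(ts_subL ts2).
by move=> i lt_i; apply/acyclic_shift; apply: acL2 => //; lia.
Qed.

(** Replacing [X] by a shift, one may assume that its cohomology lies above the
    degree [N] beyond which objects of the aisle are acyclic, so that the aisle
    has no maps to [X].  The truncation triangle is applied to a brutal
    truncation of [X], in a degree [b] that lies below the cohomology of [X]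
    and of all objects of the coaisle. *)
Lemma Kmb_proj_sub_Kb : findim_finite R^c ->
  has_bounded_t_structure (@Kb_proj R) -> subcat (@Kmb_proj R) (@Kb_proj R).
Proof.
move=> findim [L [G bts]] X0 [X1 [[t bX1] [a0 [b0 acX1]] projX1 X01]].
have [ts _ _] := bts.
have [N acL] := aisle_acyclic ts (Kb_proj_stalk R 0) (@Kb_proj_sub_Kmb R) bts findim.
have [m acG] := coaisle_acyclic ts (Kb_proj_stalk R 0) bts.
apply: (Kb_proj_iso (X := X1)); last exact: hiso_sym.
pose X := shift (a0 - N - 1) X1; apply: (Kb_proj_unshift (n := a0 - N - 1)).
rewrite -/X; have bX : bounded_above X.
  by exists (t - (a0 - N - 1)) => i lt_i x; apply: bX1; lia.
have projX i : fg_proj (X i) by apply: projX1.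
have acX i : i <= N -> acyclic_at X i.
  by move=> le_iN; apply/acyclic_shift/acX1; lia.
clearbody X.
have [b [lt_bm le_bN]] : exists b, b < m /\ b <= N.
  by exists (Order.min (m - 1) N); lia.
have KbP : Kb_proj (brutal X b).
  exists (brutal X b); split; last exact: hiso_refl.
    have [t' bX'] := bX; exists b, t' => i lt_i x.
    have [lt_ib|lt_ti] := orP lt_i; first exact: brutal_eq0.
    by apply: val_inj; rewrite [LHS]bX' // linear0.
  by move=> i; apply: fg_proj_brutal.
have [U [V [u [v [w [LU GV tri]]]]]] := ts_trunc ts KbP.
have {}LU := ts_monoL ts LU.
(* The inclusion of [brutal X b] vanishes on [U], so it factors through [V]. *)
have [g gv] : exists g, homotopic (cm_comp g v) (brutal_incl X b).
  apply: triangle_extend tri _.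
  apply: (@Kmb_proj_null _ _ _ _ N) => //; last exact: acL.
  exact/Kb_proj_sub_Kmb/(ts_subL ts).
have [v' v'P] : exists v' : chain_map X V,
    forall i x, cm_comp v' (brutal_incl X b) i x = v i x.
  apply: chain_map_extend => i lt_i; first by have [] := projX i.
  by apply: acG => //; lia.
(* The homotopy is known on [brutal X b], and extends below [b] since [X] is
   acyclic there. *)
have gv' : homotopic (cm_comp g v') (cm_id X).
  have [h hP] : homotopic (cm_comp (cm_comp g v') (brutal_incl X b)) (brutal_incl X b).
    apply: homotopic_trans gv; apply: homotopic_pointwise => i x.
    exact: (congr1 (g i) (v'P i x)).
  pose h0 i j : {linear X i -> X j} :=
    if pselect (b <= i) is left e then h i j \o brutal_lift X e else \0.
  have h0E i j (e : b <= i) x : h0 i j x = h i j (brutal_lift X e x).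
    by rewrite /h0; case: pselect => // e'; rewrite (bool_irrelevance e' e).
  case: (@homotopy_extend _ X X (cm_sub (cm_comp g v') (cm_id X)) b h0).
  - move=> i le_bi x; have le_bi1 : b <= i + 1 by lia.
    rewrite (h0E _ _ le_bi) (h0E _ _ le_bi1); apply: etrans (hP i (brutal_lift X le_bi x)) _.
    by congr (_ + h _ _ _); apply: val_inj.
  - by move=> i _; have [] := projX i.
  move=> h' [h'1 h'2]; exists h' => i.
  have [le_bi|lt_ib] := leP b i; first exact: h'1.
  by apply: h'2 => // j lt_j; apply: acX; lia.
have [Q [[q [q' Q0]] _ [c [c' [c'c _]]]]] := ts_subG ts GV.
(* Below the bounded complex [Q], the identity of [X] is thus contracted. *)
have [h hP] : homotopic (cm_id X) (cm_comp (cm_comp g c') (cm_comp c v')).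
  apply: homotopic_trans (homotopic_sym gv') _.
  apply: homotopic_trans (homotopic_compl g (homotopic_sym (homotopic_comp1 v' c'c))) _.
  exact: homotopic_pointwise.
apply: (@Kb_proj_of_contraction _ X h (q - 1)) => // i le_iq x.
have lt_iq : (i < q) || (q' < i) by lia.
by have := hP i x; rewrite /= [c i _]Q0 // linear0 [g i _]linear0 subr0.
Qed.
End TStructure.

(** * Quasi-isomorphisms *)

Section Cohomology.
Variable R : pzRingType.
Implicit Types (X Y Z : cochain R) (i j k : int).

Definition cohom_inj X Y (f : chain_map X Y) i :=
  forall x : X i, cdiff X i (i + 1) x = 0 ->
    (exists y, cdiff Y (i - 1) i y = f i x) -> exists x', cdiff X (i - 1) i x' = x.

Definition cohom_surj X Y (f : chain_map X Y) i :=
  forall y : Y i, cdiff Y i (i + 1) y = 0 ->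
    exists x : X i, cdiff X i (i + 1) x = 0 /\
      exists y', y = f i x + cdiff Y (i - 1) i y'.

Lemma cohom_injE X Y (f : chain_map X Y) i j k (x : X j) y : cohom_inj f j ->
  j = i + 1 -> k = j + 1 -> cdiff X j k x = 0 -> cdiff Y i j y = f j x ->
  exists x', cdiff X i j x' = x.
Proof.
move=> fj ji kj; have ij : i = j - 1 by lia.
by subst i; subst k => dx dy; apply: fj => //; exists y.
Qed.

Lemma cohom_surjE X Y (f : chain_map X Y) i j k (y : Y j) : cohom_surj f j ->
  j = i + 1 -> k = j + 1 -> cdiff Y j k y = 0 ->
  exists x, cdiff X j k x = 0 /\ exists y', y = f j x + cdiff Y i j y'.
Proof.
move=> fj ji kj; have ij : i = j - 1 by lia.
by subst i; subst k; apply: fj.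
Qed.

Lemma cohom_injI X Y (f : chain_map X Y) i j k : j = i + 1 -> k = j + 1 ->
  (forall x y, cdiff X j k x = 0 -> cdiff Y i j y = f j x ->
     exists x', cdiff X i j x' = x) -> cohom_inj f j.
Proof.
move=> ji kj fj; have ij : i = j - 1 by lia.
by subst i; subst k => x dx [y dy]; apply: fj dy.
Qed.

Lemma cohom_inj_homotopic X Y (f g : chain_map X Y) i :
  homotopic f g -> cohom_inj f i -> cohom_inj g i.
Proof.
move=> [h hP] fi x dx [y dy]; apply: fi => //; exists (y + h i (i - 1) x).
by rewrite linearD dy -[RHS](subrK (g i x)) hP dx linear0 addr0 addrC.
Qed.

Lemma cohom_surj_homotopic X Y (f g : chain_map X Y) i :
  homotopic f g -> cohom_surj f i -> cohom_surj g i.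
Proof.
move=> [h hP] fi y /fi[x [dx [y' ->]]]; exists x; split=> //.
exists (h i (i - 1) x + y'); rewrite linearD addrA; congr (_ + _).
by rewrite -[LHS](subrK (g i x)) hP dx linear0 addr0 addrC.
Qed.

Lemma cohom_inj_comp X Y Z (g : chain_map Y Z) (f : chain_map X Y) i :
  cohom_inj g i -> cohom_inj f i -> cohom_inj (cm_comp g f) i.
Proof.
move=> gi fi x dx bx; apply: fi => //; apply: gi => //.
by rewrite -cmapP dx linear0.
Qed.

Lemma cohom_inj_of_comp X Y Z (g : chain_map Y Z) (f : chain_map X Y) i :
  cohom_inj (cm_comp g f) i -> cohom_inj f i.
Proof.
move=> gfi x dx [y dy]; apply: gfi => //; exists (g (i - 1) y).
by rewrite -cmapP dy.
Qed.

Lemma cohom_surj_of_comp X Y Z (g : chain_map Y Z) (f : chain_map X Y) i :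
  cohom_surj (cm_comp g f) i -> cohom_surj g i.
Proof.
move=> gfi z /gfi[x [dx [z' ->]]]; exists (f i x); split; last by exists z'.
by rewrite -cmapP dx linear0.
Qed.

Lemma cohom_surj_cancel X Y Z (g : chain_map Y Z) (f : chain_map X Y) i :
  cohom_inj g i -> cohom_surj (cm_comp g f) i -> cohom_surj f i.
Proof.
move=> gi gfi y dy; have [|x [dx [z' e]]] := gfi (g i y).
  by rewrite -cmapP dy linear0.
have [||y' dy'] := gi (y - f i x); first by rewrite linearB dy -cmapP dx linear0 subrr.
  by exists z'; rewrite linearB e /= [RHS]addrAC subrr add0r.
by exists x; split=> //; exists y'; rewrite dy' addrC subrK.
Qed.

Lemma cohom_inj_cancel X Y Z (g : chain_map Y Z) (f : chain_map X Y) i :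
  cohom_inj (cm_comp g f) i -> cohom_surj f i -> cohom_inj g i.
Proof.
move=> gfi fi y /fi[x [dx [y' ->]]] [z dz].
have [//||x' dx'] := gfi x.
  by exists (z - g (i - 1) y'); rewrite linearB dz linearD /= cmapP addrK.
by exists (f (i - 1) x' + y'); rewrite linearD -cmapP dx'.
Qed.

Lemma acyclic_of_inj X Y (f : chain_map X Y) i :
  cohom_inj f i -> acyclic_at Y i -> acyclic_at X i.
Proof. by move=> fi acY x dx; apply: fi => //; apply: acY; rewrite -cmapP dx linear0. Qed.

Lemma hequiv_quasi_iso X Y (f : chain_map X Y) : hequiv f -> quasi_iso f.
Proof.
move=> [g [gf fg]] i; split.
  apply: (@cohom_inj_of_comp _ _ _ g).
  apply: cohom_inj_homotopic (homotopic_sym gf) _.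
  by have [] := quasi_iso_id X i.
apply: (@cohom_surj_of_comp _ _ _ _ g).
apply: cohom_surj_homotopic (homotopic_sym fg) _.
by have [] := quasi_iso_id Y i.
Qed.

(** The relevant part of the long exact cohomology sequence of the cone. *)
Lemma cone_acyclic X Y (f : chain_map X Y) i :
  cohom_surj f i -> cohom_inj f (i + 1) -> acyclic_at (cone f) i.
Proof.
have [i0 ->] : exists i0, i = i0 + 1 by exists (i - 1); lia.
move=> f_surj f_inj; apply: (acyclicI (i := i0) (k := i0 + 1 + 1)) => // -[x y].
rewrite cone_diffE => /pair_equal_spec/=[dx fxdy].
have {}dx : cdiff X (i0 + 1 + 1) (i0 + 1 + 1 + 1) x = 0.
  by apply/eqP; rewrite -oppr_eq0 dx.
have fx : f (i0 + 1 + 1) x = - cdiff Y (i0 + 1) (i0 + 1 + 1) y.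
  by apply/eqP; rewrite -addr_eq0 fxdy.
have [|x' dx'] := cohom_injE (i := i0 + 1) (y := - y) f_inj erefl erefl dx.
  by rewrite linearN fx.
have [|x'' [dx'' [y' yE]]] :=
    cohom_surjE (i := i0) (k := i0 + 1 + 1) (y := y + f (i0 + 1) x') f_surj erefl erefl.
  by rewrite linearD -cmapP dx' fx addrN.
exists (x'' - x', y'); rewrite cone_diffE /= linearB dx'' dx' sub0r opprK.
by congr pair; rewrite linearB [LHS]addrAC -yE addrK.
Qed.
End Cohomology.

(** * Resolutions of bounded complexes over a coherent ring *)

Section Resolution.
Variable R : pzRingType.
Hypothesis cohR : left_coherent R.
Variables (X : cochain R) (t : int).
Hypothesis presX : forall i, fin_pres (X i).
Hypothesis X0 : forall i, t <= i -> forall x : X i, x = 0.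

(** The resolution is built downwards.  All that the construction in the next
    degree needs is the lowest module, here in degree [t - k], with its map to
    [X] and its differential; [st_target], which will be the module constructed
    one step before, is kept as an arbitrary module so that consecutive stages
    match by conversion. *)
Record stage (k : nat) := Stage {
  st_mod : lmodType R;
  st_proj : fg_proj st_mod;
  st_map : {linear st_mod -> X (t - k%:Z)};
  st_target : lmodType R;
  st_pres : fin_pres st_target;
  st_diff : {linear st_mod -> st_target}
}.

Section Next.
Variables (k : nat) (s : stage k).

(** Up to signs, the kernel of this map consists of the cycles of the cone of
    the map to [X]; a free module surjecting onto it makes the cone acyclic. *)
Definition next_cycles :
    {linear (st_mod s * X (t - k.+1%:Z))%type -> (st_target s * X (t - k%:Z))%type} :=
  pair_map (st_diff s \o fst) ((st_map s \o fst) \- (cdiff X _ _ \o snd)).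

Fact next_fg : fin_gen (sub_of (kernel_sub next_cycles)).
Proof.
apply: coherent_kernel => //; last by apply: fin_pres_prod => //; apply: st_pres.
have [[m [p p_surj]] [n [q q_surj]]] :
    fin_gen (st_mod s) /\ fin_gen (X (t - k.+1%:Z)).
  split; first by have [] := st_proj s.
  by have [m [n [g [p [p_surj _]]]]] := presX (t - k.+1%:Z); exists n, p.
exists (m + n)%N, (pair_map (p \o lsubmx) (q \o rsubmx)) => -[y z].
have [x xy] := p_surj y; have [x' xz] := q_surj z.
by exists (row_mx x x'); rewrite /= row_mxKl row_mxKr xy xz.
Qed.

Let n := sval (cid next_fg).
Let pi : {linear 'rV[R]_n -> sub_of (kernel_sub next_cycles)} :=
  sval (cid (svalP (cid next_fg))).
Let pair : {linear 'rV[R]_n -> (st_mod s * X (t - k.+1%:Z))%type} := val \o pi.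

Definition next_stage : stage k.+1 :=
  @Stage k.+1 'rV[R]_n (fg_proj_row R n) (snd \o pair) (st_mod s)
    (fg_proj_pres (st_proj s)) (fst \o pair).

Lemma next_stage_cycle (x : 'rV[R]_n) :
  st_diff s (st_diff next_stage x) = 0 /\
  st_map s (st_diff next_stage x) = cdiff X _ _ (st_map next_stage x).
Proof.
have /pair_equal_spec[/= d0 /eqP] := subP (pi x).
by rewrite subr_eq0 => /eqP.
Qed.

Lemma next_stage_exact p x : st_diff s p = 0 -> st_map s p = cdiff X _ _ x ->
  exists a : 'rV[R]_n, st_diff next_stage a = p /\ st_map next_stage a = x.
Proof.
move=> dp px; have cyc : kernel_sub next_cycles (p, x).
  by apply/pair_equal_spec; rewrite /= dp px subrr.
have [a aP] := svalP (cid (svalP (cid next_fg))) (mksub cyc).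
by exists a; rewrite /next_stage /= /pair /= /pi aP.
Qed.
End Next.

Definition stage0 : stage 0 :=
  @Stage 0 'rV[R]_0 (fg_proj_row R 0) \0 'rV[R]_0 (fg_proj_pres (fg_proj_row R 0)) \0.

Fixpoint stages k : stage k := if k is k'.+1 then next_stage (stages k') else stage0.

Let P k := st_mod (stages k).
Let D k : {linear P k.+1 -> P k} := st_diff (stages k.+1).
Let F k : {linear P k -> X (t - k%:Z)} := st_map (stages k).

Let P0 (x : P 0) : x = 0.
Proof. by apply/rowP => -[]. Qed.

Let DD k x : D k (D k.+1 x) = 0.
Proof. exact: (next_stage_cycle (s := stages k.+1) x).1. Qed.

Let FD k x : F k (D k x) = cdiff X _ _ (F k.+1 x).
Proof. exact: (next_stage_cycle (s := stages k) x).2. Qed.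

(* In degree [t] the differential is zero, so that all elements are cycles. *)
Let cycle k : P k -> Prop := if k is k'.+1 then fun p => D k' p = 0 else fun=> True.

Let exactD k (p : P k) x : cycle p -> F k p = cdiff X _ _ x ->
  exists a, D k a = p /\ F k.+1 a = x.
Proof.
move=> dp; apply: next_stage_exact.
by case: k p x dp => [|k] p x dp; first by apply/rowP => -[].
Qed.

(** The sequence [P] placed in cohomological degrees: degree [t - k] holds
    [P k], and all degrees above [t] hold the zero module [P 0]. *)
Let pos (i : int) : nat := if (t - i)%R is Posz k then k else 0%N.

Let posE k : pos (t - k%:Z) = k.
Proof. by rewrite /pos subKr. Qed.

Let pos0 i (x : P (pos i)) : t <= i -> x = 0.
Proof.
move=> le_ti; have e : pos i = 0%N by rewrite /pos; case E: (t - i) => //; lia.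
by move: (pos i) e x => a ->; apply: P0.
Qed.

Let res_diff i j : {linear P (pos i) -> P (pos j)} :=
  if j == i + 1 then
    (D (pos j) \o transport P (pos i) (pos j).+1 : {linear P (pos i) -> P (pos j)})
  else \0.

Let embed k : {linear P k -> P (pos (t - k%:Z))} := transport P k (pos (t - k%:Z)).

Let embed_inj k x : embed k x = 0 -> x = 0.
Proof. by move=> e; rewrite -(transportK x (esym (posE k))) -/(embed k x) e linear0. Qed.

Let embed_surj k z : exists x, embed k x = z.
Proof. by exists (transport P _ k z); rewrite /embed transportK. Qed.

Let res_diffE k x :
  res_diff (t - k.+1%:Z) (t - k%:Z) (embed k.+1 x) = embed k (D k x).
Proof.
rewrite /res_diff /embed ifT; last lia.
move: (pos (t - k.+1%:Z)) (posE k.+1) => a ->.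
by move: (pos (t - k%:Z)) (posE k) => b ->; rewrite /= !transport_id.
Qed.

Let above_or_at i : t < i \/ exists k : nat, i = t - k%:Z.
Proof.
have [lt_ti|le_it] : t < i \/ i <= t by lia.
  by left.
by right; exists `|(t - i)%R|%N; lia.
Qed.

Let res_diff_eq0 i j : j != i + 1 -> forall x, res_diff i j x = 0.
Proof. by rewrite /res_diff => /negPf->. Qed.

Let res_diffK i j k x : res_diff j k (res_diff i j x) = 0.
Proof.
have [ji|/res_diff_eq0->] := eqVneq j (i + 1); last by rewrite linear0.
have [kj|/res_diff_eq0->//] := eqVneq k (j + 1).
have [lt_tk|[m km]] := above_or_at k; first by apply: pos0; lia.
have jm : j = t - m.+1%:Z by lia.
have im : i = t - m.+2%:Z by lia.
clear ji kj; subst i j k.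
by have [y <-] := embed_surj x; rewrite !res_diffE DD linear0.
Qed.

Let res : cochain R := Cochain res_diff_eq0 res_diffK.

Let res_map i : {linear res i -> X i} := transport X (t - (pos i)%:Z) i \o F (pos i).

Let res_mapE k x : res_map (t - k%:Z) (embed k x) = F k x.
Proof.
rewrite /res_map /embed /=; move: (pos (t - k%:Z)) (posE k) => a ->.
by rewrite !transport_id.
Qed.

Let res_mapP i j : j = i + 1 -> forall x,
  res_map j (cdiff res i j x) = cdiff X i j (res_map i x).
Proof.
move=> ji x; have [lt_tj|[k jk]] := above_or_at j.
  have -> : x = 0 by apply: pos0; lia.
  by rewrite !linear0.
have ik : i = t - k.+1%:Z by lia.
clear ji; subst i j; have [y <-] := embed_surj x.
by rewrite [cdiff res _ _ _]res_diffE !res_mapE FD.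
Qed.

Lemma coherent_resolution : exists (Q : cochain R) (f : chain_map Q X),
  [/\ bounded_above Q, forall i, fg_proj (Q i) & quasi_iso f].
Proof.
exists res, (chain_mapI res_mapP); split.
- by exists t => i lt_ti x; apply: pos0; lia.
- by move=> i; apply: st_proj.
move=> i; split.
  have [lt_ti|[k ik]] := above_or_at i.
    by move=> x _ _; exists 0; rewrite linear0; apply/esym/pos0; lia.
  subst i; apply: (cohom_injI (i := t - k.+1%:Z) (k := t - k%:Z + 1)); try lia.
  move=> z y; have [x <-] := embed_surj z => dx dy.
  have [|a [Da Fa]] := @exactD k x y _ (esym (etrans dy (res_mapE x))).
    case: k x y {z} dx dy => // k x y dx _.
    apply: embed_inj; rewrite -res_diffE; move: dx.
    by rewrite (_ : t - k.+1%:Z + 1 = t - k%:Z) //; lia.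
  by exists (embed k.+1 a); rewrite [LHS]res_diffE Da.
have [lt_ti|[[|k] ik]] := above_or_at i.
- move=> y _; exists 0; rewrite !linear0; split=> //; exists 0.
  by rewrite linear0 addr0 [LHS]X0 // ltW.
- move=> y _; exists 0; rewrite !linear0; split=> //; exists 0.
  by rewrite linear0 addr0 [LHS]X0 //; lia.
subst i => y; rewrite (_ : t - k.+1%:Z + 1 = t - k%:Z) => [dy|]; last lia.
have [||a [Da Fa]] := @exactD k 0 y; first by case: k {y dy} => //= k; rewrite linear0.
  by rewrite linear0 dy.
exists (embed k.+1 a); split; first by rewrite [LHS]res_diffE Da linear0.
by exists 0; rewrite linear0 addr0 -Fa; apply/esym/res_mapE.
Qed.
End Resolution.

(** * The bounded derived category of a coherent ring *)

Section Derived.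
Variable R : pzRingType.
Implicit Types (X Y P W : cochain R) (i j : int).

Lemma fg_proj_bounded_fp P : bounded P -> (forall i, fg_proj (P i)) -> bounded_fp P.
Proof. by move=> bP projP; split=> // i; apply: fg_proj_pres. Qed.

Lemma Db_iso_of_quasi_iso X P (f : chain_map P X) :
  bounded_fp X -> bounded_fp P -> quasi_iso f -> Db_iso X P.
Proof.
move=> fpX fpP qf.
pose p : roof X P := Roof fpP (cm_id P) qf.
pose q : roof P X := Roof fpP f (quasi_iso_id P).
exists fpX, fpP, p, q; split.
  exists P, fpP, (cm_id P), (cm_id P), (quasi_iso_id P).
  split; first exact: homotopic_pointwise.
  exists P, (cm_id P), f; split=> //.
  split; [|exact: homotopic_pointwise..].
  exact: quasi_iso_comp (quasi_iso_comp qf (quasi_iso_id P)) (quasi_iso_id P).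
exists P, fpP, (cm_id P), (cm_id P), (quasi_iso_id P).
split; first exact: homotopic_pointwise.
exists P, (cm_id P), (cm_id P); split=> //.
split; [|exact: homotopic_pointwise..].
have q1 := quasi_iso_id P.
exact: quasi_iso_comp (quasi_iso_comp q1 q1) q1.
Qed.

(** A bounded above complex of projectives lifts through quasi-isomorphisms,
    since it has no maps to the cone. *)
Lemma quasi_iso_section P W (w : chain_map W P) : bounded_above P ->
  (forall i, projective (P i)) -> quasi_iso w ->
  exists s : chain_map P W, homotopic (cm_comp w s) (cm_id P).
Proof.
move=> bP projP qw; have [t P0] := bP; apply: cone_in_null_section.
apply: (@null_homotopic_amplitude _ _ _ _ t) => // i lt_i.
  by apply: acyclic_zero; apply: P0.
by apply: cone_acyclic; [have [] := qw i | have [] := qw (i + 1)].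
Qed.

(** On cohomology the backward legs are invertible, so that the two forward legs
    compose, up to isomorphisms, to the identity of the cohomology of [X]. *)
Lemma roof_comp_id_cohom X Y (fpX : bounded_fp X) (r : roof X Y) (s : roof Y X) i :
  is_roof_comp r s (roof_id fpX) ->
  cohom_inj (forth r) i /\ cohom_surj (forth s) i.
Proof.
move=> [W [fpW [a [b [qa [ab [W' [a' [b' [_ [/= q_back back_eq forth_eq]]]]]]]]]]].
have back_forth : homotopic (cm_comp (cm_comp (forth s) b) a')
                            (cm_comp (cm_comp (back r) a) a').
  apply: homotopic_trans forth_eq _; exact: homotopic_sym.
have [inj_back surj_back] := q_back i.
split.
  have surj_aa' : cohom_surj (cm_comp a a') i.
    apply: (@cohom_surj_cancel _ _ _ _ (back r)); first by have [] := back_qis r i.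
    by apply: cohom_surj_homotopic surj_back; apply: homotopic_pointwise.
  apply: (@cohom_inj_cancel _ _ _ _ _ (cm_comp a a')) => //.
  apply: (@cohom_inj_homotopic _ _ _ (cm_comp (back s) (cm_comp b a'))).
    apply: homotopic_trans (homotopic_compA _ _ _) _.
    apply: homotopic_trans (homotopic_compr a' (homotopic_sym ab)) _.
    exact: homotopic_pointwise.
  apply: cohom_inj_comp; first by have [] := back_qis s i.
  apply: (@cohom_inj_of_comp _ _ _ _ (forth s)).
  apply: cohom_inj_homotopic inj_back.
  apply: homotopic_trans (homotopic_sym back_forth) _.
  exact: homotopic_pointwise.
apply: (@cohom_surj_of_comp _ _ _ _ _ (cm_comp b a')).
apply: cohom_surj_homotopic surj_back.
apply: homotopic_trans (homotopic_sym back_forth) _.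
exact: homotopic_pointwise.
Qed.

Lemma quasi_iso_of_Db_iso X P : bounded P -> (forall i, fg_proj (P i)) ->
  Db_iso X P -> exists f : chain_map P X, quasi_iso f.
Proof.
move=> [a [b P0]] projP [fpX [fpP [p [q [pq qp]]]]].
have [||s sP] := @quasi_iso_section P (apex q) (back q) _ _ (back_qis q).
- by exists b => i lt_i; apply: P0; rewrite lt_i orbT.
- by move=> i; have [] := projP i.
exists (cm_comp (forth q) s); apply: quasi_iso_comp.
  by move=> i; have [_ ?] := roof_comp_id_cohom i pq;
    have [? _] := roof_comp_id_cohom i qp.
move=> i; have [inj_b surj_b] := back_qis q i; split.
  apply: (@cohom_inj_of_comp _ _ _ _ (back q)).
  apply: cohom_inj_homotopic (homotopic_sym sP) _.
  by have [] := quasi_iso_id P i.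
apply: (@cohom_surj_cancel _ _ _ _ (back q)) => //.
apply: cohom_surj_homotopic (homotopic_sym sP) _.
by have [] := quasi_iso_id P i.
Qed.

Lemma Kb_proj_eq_Db_mod_of_eq : left_coherent R ->
  subcat (@Kmb_proj R) (@Kb_proj R) -> Kb_proj_eq_Db_mod R.
Proof.
move=> cohR KmbK X fpX; have [[a [b X0]] presX] := fpX.
have [|Q [f [bQ projQ qf]]] := @coherent_resolution _ cohR X (b + 1) presX.
  by move=> i lt_i; apply: X0; lia.
have [|P [bP projP [c c_eq]]] := KmbK Q.
  exists Q; split=> //; last exact: hiso_refl.
  exists a, b => i lt_i; apply: (@acyclic_of_inj _ _ _ f); first by have [] := qf i.
  by apply: acyclic_zero; apply: X0.
have [c' [c'c cc']] := c_eq.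
exists P; split=> //; apply: (@Db_iso_of_quasi_iso _ _ (cm_comp f c')) => //.
  exact: fg_proj_bounded_fp.
by apply: quasi_iso_comp => //; apply: hequiv_quasi_iso; exists c.
Qed.

Section CanonicalTruncation.
Variables (X : cochain R) (a : int).

(* Below degree [a], the differential to degree [a + 1] is zero, so that the
   kernel is everything. *)
Let S i := cut (i <= a) (cdiff X i (a + 1)).

Fact smart_closed i x : S i x -> S (i + 1) (cdiff X i (i + 1) x).
Proof.
rewrite /S /=; have [lt_ia|lt_ai|ia] := ltgtP i a.
- by move=> _; rewrite ifT ?cdiffK //; lia.
- by move=> ->; rewrite linear0; case: ifP; rewrite ?linear0.
by subst i => dx; rewrite dx linear0; case: ifP.
Qed.

Definition smart := subcomplex smart_closed.
Definition smart_incl : chain_map smart X := subcomplex_incl smart_closed.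

Lemma smart_eq0 i (x : smart i) : a < i -> x = 0.
Proof. by move=> lt_ai; apply: cut_eq0; rewrite -ltNge. Qed.

Lemma smart_cohom_surj i : i <= a -> cohom_surj smart_incl i.
Proof.
move=> le_ia x dx; have Sx : S i x.
  rewrite /S /= le_ia; have [ia|ne_ia] := eqVneq i a; first by subst i.
  by rewrite cdiff_eq0 //; lia.
exists (mksub Sx); split; last by exists 0; rewrite linear0 addr0.
by apply: val_inj.
Qed.

Lemma smart_cohom_inj i : i <= a + 1 -> cohom_inj smart_incl i.
Proof.
move=> le_ia x _ [y dy].
have [le_ia'|lt_ai] : i <= a \/ a < i by lia.
  have Sy : S (i - 1) y by rewrite /S /= ifT ?cdiff_eq0 //; lia.
  by exists (mksub Sy); apply: val_inj.
by exists 0; rewrite linear0 (smart_eq0 x lt_ai).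
Qed.

Lemma smart_bounded : bounded X -> bounded smart.
Proof.
move=> [b [b' X0]]; exists b, b' => i lt_i x.
by apply: val_inj; rewrite [LHS]X0 // linear0.
Qed.

Lemma smart_fin_pres : left_coherent R -> (forall i, fg_proj (X i)) ->
  forall i, fin_pres (smart i).
Proof.
move=> cohR projX i; have [le_ia|lt_ai] : i <= a \/ a < i by lia.
  have presX j : fin_pres (X j) by apply: fg_proj_pres.
  have [m [n [g [p [p_surj p_ker]]]]] :=
    coherent_kernel_pres cohR (cdiff X i (a + 1)) (presX _) (presX _).
  have pS x : S i ((val \o p) x).
    by rewrite /S /= le_ia; apply: (subP (p x)).
  exists m, n, g, (corestrict pS); split=> [z | x].
    have kz : kernel_sub (cdiff X i (a + 1)) (val z).
      by move: (val z) (subP z) => y; rewrite /S /= le_ia.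
    have [x xz] := p_surj (mksub kz); exists x.
    by apply: val_inj; rewrite corestrictE /= xz.
  rewrite -p_ker; split=> [/(congr1 val) px | px].
    by apply: val_inj; rewrite linear0; apply: px.
  by apply: val_inj; rewrite corestrictE /= px.
by apply: fg_proj_pres; apply: fg_proj0 => x; apply: smart_eq0.
Qed.
End CanonicalTruncation.

Definition standard_aisle X := Kb_proj X /\ forall i, 0 < i -> acyclic_at X i.
Definition standard_coaisle X := Kb_proj X /\ forall i, i < 0 -> acyclic_at X i.

Lemma standard_aisle_iso : iso_closed standard_aisle.
Proof.
move=> X Y [KX acX] XY; split; first exact: Kb_proj_iso KX XY.
by move=> i /acX; apply: acyclic_hiso (hiso_sym XY).
Qed.

Lemma standard_coaisle_iso : iso_closed standard_coaisle.
Proof.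
move=> X Y [KX acX] XY; split; first exact: Kb_proj_iso KX XY.
by move=> i /acX; apply: acyclic_hiso (hiso_sym XY).
Qed.

Lemma deg_standard_aisle n X :
  deg standard_aisle n X <-> Kb_proj X /\ forall i, n < i -> acyclic_at X i.
Proof.
rewrite degE; last exact: standard_aisle_iso.
split=> -[KX acX]; split.
- exact: Kb_proj_unshift KX.
- move=> i lt_i; have /acyclic_shift := acX (i - n) ltac:(lia).
  by rewrite subrK.
- exact: Kb_proj_shift.
- by move=> i lt_i; apply/acyclic_shift; apply: acX; lia.
Qed.

Lemma deg_standard_coaisle n X :
  deg standard_coaisle n X <-> Kb_proj X /\ forall i, i < n -> acyclic_at X i.
Proof.
rewrite degE; last exact: standard_coaisle_iso.
split=> -[KX acX]; split.
- exact: Kb_proj_unshift KX.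
- move=> i lt_i; have /acyclic_shift := acX (i - n) ltac:(lia).
  by rewrite subrK.
- exact: Kb_proj_shift.
- by move=> i lt_i; apply/acyclic_shift; apply: acX; lia.
Qed.

(** The truncation of a perfect complex below degree [0] is a bounded complex of
    finitely presented modules, by coherence, hence quasi-isomorphic to a
    perfect complex [Q]; the cone of [Q] over the given complex is then perfect
    as well, and acyclic below [0]. *)
Lemma has_standard_t_structure : left_coherent R -> Kb_proj_eq_Db_mod R ->
  has_bounded_t_structure (@Kb_proj R).
Proof.
move=> cohR KD; exists standard_aisle, standard_coaisle; split; first split.
- by move=> X [].
- by move=> X [].
- exact: standard_aisle_iso.
- exact: standard_coaisle_iso.
- by move=> X /deg_standard_aisle[KX acX]; split=> // i lt_i; apply: acX; lia.
- by move=> X [KX acX]; apply/deg_standard_coaisle; split=> // i lt_i; apply: acX; lia.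
- move=> X Y f /deg_standard_aisle[KX acX] [_ acY].
  apply: (@Kmb_proj_null _ _ _ _ (-1)) => [|//|i le_i]; first exact: Kb_proj_sub_Kmb.
  by apply: acY; lia.
- move=> X [P [bP projP [b [b' [b'b bb']]]]].
  have fp_tau : bounded_fp (smart P (-1)).
    by split; [apply: smart_bounded | apply: smart_fin_pres].
  have [Q [bQ projQ XQ]] := KD _ fp_tau.
  have [q qq] := quasi_iso_of_Db_iso bQ projQ XQ.
  pose f := cm_comp (smart_incl P (-1)) q.
  have KQ : Kb_proj Q by exists Q; split=> //; apply: hiso_refl.
  exists Q, (cone f), (cm_comp b' f), (cm_comp (cone_in f) b), (cone_out f).
  split; last exact: triangle_cone.
    apply/deg_standard_aisle; split=> // i lt_i.
    apply: (@acyclic_of_inj _ _ _ q); first by have [] := qq i.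
    by apply: acyclic_zero => x; apply: smart_eq0.
  split.
    exists (cone f); split; last exact: hiso_refl.
      have [c [c' Q0]] := bQ; have [d [d' P0]] := bP.
      exists (Order.min (c - 1) d), (Order.max (c' - 1) d') => i lt_i [x y].
      by congr pair; [apply: Q0; lia | apply: P0; lia].
    by move=> i; apply: fg_proj_prod.
  move=> i lt_i; apply: cone_acyclic.
    move=> y /(@smart_cohom_surj P (-1) i ltac:(lia))[z [dz [y' ->]]].
    have [_ /(_ z dz)[x [dx [z' ->]]]] := qq i; exists x; split=> //.
    exists (smart_incl P (-1) (i - 1) z' + y').
    by rewrite [in RHS]linearD [RHS]addrA; congr (_ + _); rewrite linearD cmapP.
  apply: cohom_inj_comp; last by have [] := qq (i + 1).
  by apply: smart_cohom_inj; lia.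
- move=> X; split=> [[P [[b [b' P0]] projP XP]] | [n /deg_standard_aisle[]] //].
  exists `|b'|%N; apply/deg_standard_aisle; split.
    by exists P; split=> //; exists b, b'.
  move=> i lt_i; apply: acyclic_hiso XP _; apply: acyclic_zero => x; apply: P0; lia.
move=> X; split=> [[P [[b [b' P0]] projP XP]] | [n /deg_standard_coaisle[]] //].
exists `|b|%N; apply/deg_standard_coaisle; split.
  by exists P; split=> //; exists b, b'.
move=> i lt_i; apply: acyclic_hiso XP _; apply: acyclic_zero => x; apply: P0; lia.
Qed.
End Derived.

Theorem corollary1p9 (R : pzRingType) (hfin : findim_finite R^c) :
  ((has_bounded_t_structure (@Kb_proj R) ->
      forall X : cochain R, Kb_proj X <-> Kmb_proj X)
   /\ (left_coherent R ->
      (has_bounded_t_structure (@Kb_proj R) <-> Kb_proj_eq_Db_mod R)))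
  /\ (forall T : cochain R -> Prop,
        triangulated T ->
        (forall X, Kb_proj X -> T X) -> (forall X, T X -> Kmb_proj X) ->
        forall L1 G1 L2 G2 : cochain R -> Prop,
          bounded_t_structure T L1 G1 -> bounded_t_structure T L2 G2 ->
          t_equivalent L1 L2).
Proof.
split; first split.
- move=> bts X; split; first exact: Kb_proj_sub_Kmb.
  exact: Kmb_proj_sub_Kb.
- move=> cohR; split; last exact: has_standard_t_structure.
  by move=> bts; apply: Kb_proj_eq_Db_mod_of_eq => //; apply: Kmb_proj_sub_Kb.
move=> T triT KbT TKmb L1 G1 L2 G2.
apply: bounded_t_structures_equivalent => //; first exact: tri_iso.
exact: tri_shift.
Qed.
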